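(* Let $m_1,m_2,m_3>0$. Within the negative energy, zero angular momentum phase space of the planar Newtonian three-body problem there is a nonempty open and unbounded set of initial conditions such that every solution with initial condition in this set is a stuttering orbit.
   Context: Planar Newtonian three-body problem: positions $q_1,q_2,q_3\in\mathbb{C}$, velocities $v_i=\dot q_i$, center of mass fixed at $0$ and total linear momentum zero, $U=\sum_{i<j}m_im_j/|q_i-q_j|$, equations $m_i\ddot q_i=\nabla_{q_i}U$, energy $\frac12\sum m_i|v_i|^2-U$. The phase space in question consists of initial conditions $(q,v)$ with negative energy and zero angular momentum (with its subspace topology). A syzygy is an instant at which the three bodies are collinear (binary collisions count as syzygies, triple collision does not). A collision-free syzygy has type $1$, $2$ or $3$ according to which mass lies between the other two. Listing the syzygy types in temporal order gives the syzygy sequence of a solution. A stuttering orbit is a solution whose syzygy sequence contains the same symbol twice in a row, i.e. ''11'', ''22'' or ''33'' occurs. *)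

(* Defs.v *)
From HB Require Import structures.
From mathcomp Require Import all_boot all_order all_algebra.
From mathcomp Require Import all_classical all_reals all_analysis.
Set Implicit Arguments.
Unset Strict Implicit.
Unset Printing Implicit Defensive.
Import Order.TTheory GRing.Theory Num.Theory.
Import numFieldNormedType.Exports.
Local Open Scope classical_set_scope.
Local Open Scope ring_scope.

(* Row [i] of a 3 x 2 real matrix is the position (or velocity) of body [i] in
   the plane, C being identified with R^2.  The bodies 1, 2, 3 are the indices
   0, 1, 2 of 'I_3. *)
Notation config R := 'M[R]_(3, 2).

Section ThreeBody.
Context {R : realType}.
Implicit Types (m : 'I_3 -> R) (q v : config R) (x : config R * config R).

(* The norm that the library puts on matrices is the sup norm, so the Euclidean
   length of the plane has to be spelled out. *)
Definition enorm (u : 'rV[R]_2) : R := Num.sqrt (\sum_(k < 2) u 0 k ^+ 2).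

Definition potential m q : R :=
  \sum_(i < 3) \sum_(j < 3 | (i < j)%N)
    m i * m j / enorm (row i q - row j q).

(* Row [i] is the gradient of U with respect to q_i, by partial derivatives. *)
Definition grad_potential m q : config R :=
  \matrix_(i < 3, k < 2) 'D_(delta_mx i k) (potential m) q.

Definition energy m q v : R :=
  2^-1 * (\sum_(i < 3) m i * enorm (row i v) ^+ 2) - potential m q.

Definition angular_momentum m q v : R :=
  \sum_(i < 3) m i * (q i 0 * v i 1 - q i 1 * v i 0).

Definition collision_free q : Prop :=
  forall i j : 'I_3, i != j -> row i q != row j q.

Definition triple_collision q : Prop := forall i j : 'I_3, row i q = row j q.

(* Since 1 / 0 = 0 in the library, [potential] is meaningful only at
   collision-free configurations. *)
Definition phase_space m : set (config R * config R) :=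
  [set x | [/\ collision_free x.1,
               \sum_(i < 3) m i *: row i x.1 = 0,
               \sum_(i < 3) m i *: row i x.2 = 0,
               energy m x.1 x.2 < 0 &
               angular_momentum m x.1 x.2 = 0]].

(* [J] is open, so the derivatives of [q] at points of [J] only depend on the
   restriction of [q] to [J]. *)
Definition solution m (J : set R) (q : R -> config R) : Prop :=
  [/\ is_interval J, open J &
      forall t, J t ->
        [/\ collision_free (q t), derivable q t 1, derivable (derive1 q) t 1 &
            forall i : 'I_3,
              m i *: row i (derive1 (derive1 q) t) = row i (grad_potential m (q t))]].

Definition maximal_solution m (J : set R) (q : R -> config R) : Prop :=
  solution m J q /\
  forall (J' : set R) (q' : R -> config R), solution m J' q' ->
    J `<=` J' -> (forall t, J t -> q' t = q t) -> J' `<=` J.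

Definition collinear q : Prop :=
  exists p d : 'rV[R]_2, forall i : 'I_3, exists s : R, row i q = p + s *: d.

Definition syzygy q : Prop := collinear q /\ ~ triple_collision q.

Definition syzygy_of_type q (j : 'I_3) : Prop :=
  [/\ collision_free q, syzygy q &
      exists i k : 'I_3, [/\ i != j, k != j, i != k &
        exists2 s : R, 0 < s < 1 & row j q = (1 - s) *: row i q + s *: row k q]].

(* The word [w] is a block of consecutive symbols of the syzygy sequence of [q]
   on [J]: [ts] lists, in increasing order, the instants at which the symbols
   of [w] occur, and there is no other syzygy, with or without collision,
   between two of these instants. *)
Definition syzygy_block (J : set R) (q : R -> config R) (w : seq 'I_3) : Prop :=
  exists ts : seq R,
    [/\ size ts = size w, sorted <%R ts,
        forall t, t \in ts -> J t,
        forall k, (k < size w)%N ->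
          syzygy_of_type (q (nth 0 ts k)) (nth ord0 w k) &
        forall s t s', s \in ts -> s' \in ts -> s <= t <= s' ->
          syzygy (q t) -> t \in ts].

Definition stuttering (J : set R) (q : R -> config R) : Prop :=
  exists j : 'I_3, syzygy_block J q [:: j; j].

End ThreeBody.

(* Main.v *)
(* A trajectory issued from a configuration at rest is invariant under time
   reversal, so its first syzygy after time 0 and its last syzygy before time 0
   have the same type.  It suffices to produce a non-collinear configuration at
   rest whose first syzygy is collision-free, in a way that is stable under
   perturbation.  Near a collinear Euler configuration [a] write the positions as
   [(x_i, e y_i)] and let [e -> 0]: the limit system has the solution
   [x = la(t) a], [y = mu(t) b], where [b] spans the remaining transverse
   eigendirection, [la'' = - w / la^2], [mu'' = - K mu / la^3] and [K > w].
   With [la = cos^2 phi], Sturm comparison of [mu] with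
   [cos phi * cos (nu phi)], [nu^2 = 2 K / w - 1 > 1], shows that [mu] changes
   sign before the total collapse [phi = pi / 2].  By Gronwall's inequality, in
   variables in which [e] is one of the coordinates, the oriented area of the true
   motion changes sign while the body 2 remains between the bodies 1 and 3.
   Unboundedness comes from the homogeneity of the Euler configurations. *)
Require Import Defs.
From mathcomp Require Import all_boot all_order all_algebra.
From mathcomp Require Import all_classical all_reals all_analysis.
From mathcomp Require Import ring lra.
Import Order.TTheory GRing.Theory Num.Theory.
Import numFieldNormedType.Exports.
Local Open Scope classical_set_scope.
Local Open Scope ring_scope.
Set Implicit Arguments.
Unset Strict Implicit.

(** * Calculus on the real line *)

Section Calculus.
Context {R : realType}.
Implicit Types (f g : R -> R) (a b c s t : R).

(** An open set contains states that are not at rest, whose motions are not symmetric under time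
    reversal. Symmetry is therefore used for the reference motion only: a nearby motion and its
    reversal both start close to the same reference state, and each is compared with the reference
    on [[0, T]].

    Dividing the second coordinates by [e] is possible because their equations are linear in their
    differences. The scale [e] then enters only through [e^2] in the distances and is a constant of
    motion, so a small [e > 0] is one more perturbation of the initial state of a reference with
    [e = 0]. The rescaled area keeps a definite sign in that limit, where the true area vanishes.

    The given solution is only known to be maximal, so its existence on [(- T, T)] has to be
    derived. A cut-off field, globally Lipschitz, supplies a motion for all times; the comparison
    shows that this motion does not meet the cutoff during [[- T, T]]; uniqueness, gluing and
    maximality then identify it there with the given solution. *)

Lemma is_deriveD_fun f g t a b : is_derive t 1 f a -> is_derive t 1 g b ->
  is_derive t 1 (fun s => f s + g s) (a + b).
Proof. by move=> fa gb; exact: is_deriveD. Qed.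

Lemma is_deriveN_fun f t a : is_derive t 1 f a -> is_derive t 1 (fun s => - f s)
    (- a).
Proof. by move=> fa; exact: is_deriveN. Qed.

Lemma is_deriveB_fun f g t a b : is_derive t 1 f a -> is_derive t 1 g b ->
  is_derive t 1 (fun s => f s - g s) (a - b).
Proof. by move=> fa gb; exact: is_deriveB. Qed.

Lemma is_deriveM_fun f g t a b : is_derive t 1 f a -> is_derive t 1 g b ->
  is_derive t 1 (fun s => f s * g s) (a * g t + f t * b).
Proof.
move=> fa gb; apply: (is_derive_eq (is_deriveM fa gb)).
by rewrite /GRing.scale /=; ring.
Qed.

Lemma is_derive_cst_fun c t : is_derive t 1 (fun=> c) 0.
Proof. exact: is_derive_cst. Qed.

Lemma is_deriveZ_fun f c t a : is_derive t 1 f a ->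
  is_derive t 1 (fun s => c * f s) (c * a).
Proof.
by move=> fa; apply: (is_derive_eq (is_deriveM_fun (is_derive_cst_fun c t) fa));
    rewrite mul0r add0r.
Qed.

Lemma is_deriveV_fun f t a : f t != 0 -> is_derive t 1 f a ->
  is_derive t 1 (fun s => (f s)^-1) (- a / f t ^+ 2).
Proof.
move=> ft0 fa; apply: (is_derive_eq (is_deriveV ft0 fa)).
by rewrite /GRing.scale /= mulrC !mulrN mulNr.
Qed.

Lemma is_derive_comp_fun f g t a b : is_derive (g t) 1 f a -> is_derive t 1 g b ->
  is_derive t 1 (fun s => f (g s)) (a * b).
Proof. by move=> fa gb; exact: is_derive1_comp. Qed.

Lemma is_derive_compN f t a : is_derive (- t) 1 f a ->
  is_derive t 1 (fun s => f (- s)) (- a).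
Proof.
move=> fa; apply: (is_derive_eq (is_derive_comp_fun fa (is_deriveN_fun
    (is_derive_id t 1)))).
by rewrite mulrN1.
Qed.

Lemma is_derive_sum_fun (I : finType) (F : I -> R -> R) (dF : I -> R) t :
  (forall i, is_derive t 1 (F i) (dF i)) ->
  is_derive t 1 (fun s => \sum_i F i s) (\sum_i dF i).
Proof.
move=> FdF; elim: (index_enum I) => [|i r IH].
  rewrite big_nil; under eq_fun do rewrite big_nil; exact: is_derive_cst_fun.
rewrite big_cons; under eq_fun do rewrite big_cons; exact: is_deriveD_fun.
Qed.

Lemma is_derive_continuous f t a : is_derive t 1 f a -> {for t, continuous f}.
Proof.
by move=> fa; apply/differentiable_continuous/derivable1_diffP; case: fa.
Qed.

Lemma is_derive_within_continuous f (df : R -> R) a b :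
  (forall s, a <= s <= b -> is_derive s 1 f (df s)) ->
  {within `[a, b], continuous f}.
Proof.
move=> H; apply: derivable_within_continuous => x; rewrite in_itv /= => /H.
by case.
Qed.

Lemma MVT_is_derive f (df : R -> R) a b : a < b ->
  (forall s, a <= s <= b -> is_derive s 1 f (df s)) ->
  exists2 c, a < c < b & f b - f a = df c * (b - a).
Proof.
move=> ab H; have [||c] := @MVT R f df a b ab.
- by move=> x; rewrite in_itv /= => /andP[ax xb]; apply: H; rewrite !ltW.
- exact: is_derive_within_continuous H.
by rewrite in_itv /= => cab E; exists c.
Qed.

Lemma is_derive_nincr f (df : R -> R) a b : a <= b ->
  (forall s, a <= s <= b -> is_derive s 1 f (df s)) ->
  (forall s, a <= s <= b -> df s <= 0) -> f b <= f a.
Proof.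
rewrite le_eqVlt => /predU1P[-> //|ab H H0].
have [c /andP[ac cb] E] := MVT_is_derive ab H.
rewrite -subr_le0 E mulr_le0_ge0 ?subr_ge0 ?(ltW ab)// H0//.
by rewrite !ltW.
Qed.

Lemma is_derive0_itv_cst f a b : (forall s, a <= s <= b -> is_derive s 1 f 0) ->
  a <= b -> f b = f a.
Proof.
move=> H ab; apply/eqP; rewrite eq_le (is_derive_nincr ab H) ?lexx//= -lerN2.
apply: (is_derive_nincr (f := fun s => - f s) (df := fun=> 0)) ab _ _ => // s /H.
by move=> /is_deriveN_fun; rewrite oppr0.
Qed.

Lemma is_derive_le_diff f g (df dg : R -> R) a b : a <= b ->
  (forall s, a <= s <= b -> is_derive s 1 f (df s)) ->
  (forall s, a <= s <= b -> is_derive s 1 g (dg s)) ->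
  (forall s, a <= s <= b -> df s <= dg s) -> f b - f a <= g b - g a.
Proof.
move=> ab Hf Hg le.
have : (f b - g b) <= (f a - g a); last by lra.
apply: (is_derive_nincr (f := fun s => f s - g s) (df := fun s => df s - dg s)) =>
    //.
  by move=> s sab; apply: is_deriveB_fun; [exact: Hf|exact: Hg].
by move=> s /le; rewrite subr_le0.
Qed.

Lemma IVT_zero f a b : continuous f -> a <= b -> f a <= 0 <= f b ->
  exists2 c, a <= c <= b & f c = 0.
Proof.
move=> cf ab /andP[fa fb]; have [||c] := @IVT R f a b 0 ab.
- exact: continuous_subspaceT.
- by rewrite ge_min fa le_max fb orbT.
by rewrite in_itv /= => cab fc; exists c.
Qed.

(** The integral needs a base point to the left of the variable, so the base [- (|x| + 1)] moves
    with [x]. Subtracting the value at 0 makes the result independent of the base ([GE]), which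
    gives differentiability on the whole line. *)
Lemma continuous_antiderivative f : continuous f ->
  exists G : R -> R, G 0 = 0 /\ forall t, is_derive t 1 G (f t).
Proof.
move=> cf.
pose P (n x : R) := \int[lebesgue_measure]_(s in `[- n, x]) f s.
have dP (n x : R) : - n < x -> is_derive x 1 (P n) (f x).
  move=> nx.
  have [] := @continuous_FTC1_closed R f (- n) x (x + 1) _ _ nx (cf x).
  - by rewrite ltrDl.
  - apply: continuous_compact_integrable; first exact: segment_compact.
    exact: continuous_subspaceT.
  by move=> d1; rewrite derive1E; exact: DeriveDef.
pose G x := P (`|x| + 1) x - P (`|x| + 1) 0.
have GE (n x : R) : `|x| < n -> G x = P n x - P n 0.
  move=> xn; rewrite /G.
  pose h y := P (`|x| + 1) y - P n y.
  have dh (y : R) : - `|x| <= y -> is_derive y 1 h 0.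
    move=> xy; apply: is_derive_eq (subrr (f y)).
    by apply: is_deriveB_fun; apply: dP; lra.
  suff : h x = h 0 by rewrite /h; lra.
  have [x0|x0] := leP 0 x.
    apply: is_derive0_itv_cst (x0) => s /andP[s0 sx]; apply: dh.
    by have := normr_ge0 x; lra.
  symmetry; apply: is_derive0_itv_cst (ltW x0) => s /andP[s0 sx]; apply: dh.
  by move: s0; rewrite ltr0_norm//; lra.
exists G; split; first by rewrite /G subrr.
move=> t; pose n := `|t| + 2.
apply: (@near_eq_is_derive _ _ _ (fun x => P n x - P n 0)).
  near=> y; symmetry; apply: GE.
  have : `|y - t| < 1.
    by rewrite distrC; near: y; exists 1 => //=.
  move=> yt; rewrite -(subrK t y) (le_lt_trans (ler_normD _ _))// /n.
  by rewrite addrC ltrD2l (lt_trans yt)// ltr1n.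
have nt : - n < t by rewrite /n; have := lerNnormlW (lexx `|t|); lra.
exact: is_derive_eq (is_deriveB_fun (dP n t nt) (is_derive_cst_fun (P n 0) t))
    (subr0 (f t)).
Unshelve. all: by end_near. Qed.

End Calculus.

(** * Global solutions of differential equations *)

Section Picard.
Context {R : realType}.
Implicit Types (a c s t d : R).

Lemma is_derive_expRZ a t : is_derive t 1 (fun s => expR (a * s)) (a * expR (a *
    t)).
Proof.
apply: (is_derive_eq (is_derive_comp_fun (is_derive_expR _) (is_deriveZ_fun a
    (is_derive_id t 1)))).
by rewrite mulr1 mulrC.
Qed.

Lemma expR_dominated_ge0 (D dD : R -> R) c a t : 0 < a -> D 0 = 0 ->
  (forall s, 0 <= s -> is_derive s 1 D (dD s)) ->
  (forall s, 0 <= s -> `|dD s| <= c * expR (a * s)) -> 0 <= t ->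
  `|D t| <= c / a * expR (a * t).
Proof.
move=> a0 D0 dDP le t0.
have c0 : 0 <= c.
  by have := le 0 (lexx 0); rewrite mulr0 expR0 mulr1; exact: le_trans.
have dE (s : R) : is_derive s 1 (fun s => c / a * expR (a * s)) (c * expR (a * s)).
  apply: (is_derive_eq (is_deriveZ_fun (c / a) (is_derive_expRZ a s))).
  by rewrite mulrA divfK // gt_eqF.
have ca0 : 0 <= c / a * expR (a * 0) by rewrite mulr_ge0 ?expR_ge0// divr_ge0// ltW.
rewrite ler_norml; apply/andP; split.
  have := @is_derive_le_diff R (fun s => - D s) _ (fun s => - dD s) _ _ _ t0
    (fun s h => is_deriveN_fun (dDP s (andP h).1)) (fun s _ => dE s).
  rewrite D0 oppr0 subr0 => h;
      have {h}/h : forall s, 0 <= s <= t -> - dD s <= c * expR (a * s).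
    by move=> s /andP[s0 _]; have := le s s0; rewrite ler_norml => /andP[]; lra.
  by lra.
have := @is_derive_le_diff R D _ dD _ _ _ t0
  (fun s h => dDP s (andP h).1) (fun s _ => dE s).
rewrite D0 subr0 => h;
    have {h}/h : forall s, 0 <= s <= t -> dD s <= c * expR (a * s).
  by move=> s /andP[s0 _]; have := le s s0; rewrite ler_norml => /andP[]; lra.
by lra.
Qed.

(** Integrating the exponential weight gains the factor [1 / a]; with [a] twice the Lipschitz
    constant this is what makes the Picard map a contraction. *)
Lemma expR_dominated (D dD : R -> R) c a t : 0 < a -> D 0 = 0 ->
  (forall s, is_derive s 1 D (dD s)) ->
  (forall s, `|dD s| <= c * expR (a * `|s|)) ->
  `|D t| <= c / a * expR (a * `|t|).
Proof.
move=> a0 D0 dDP le; have [t0|t0] := leP 0 t.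
  rewrite (ger0_norm t0); apply: (@expR_dominated_ge0 D dD) => // s s0.
  by have := le s; rewrite (ger0_norm s0).
rewrite (ltr0_norm t0) -{1}[t]opprK.
apply: (@expR_dominated_ge0 (fun s => D (- s)) (fun s => - dD (- s))) => //.
- by rewrite oppr0.
- by move=> s _; exact: is_derive_compN.
- by move=> s s0; rewrite normrN; have := le (- s); rewrite normrN (ger0_norm s0).
- by rewrite oppr_ge0 ltW.
Qed.

Lemma eq_ler (x y : R) : x = y -> x <= y. Proof. by move=> ->. Qed.

Lemma half_expn_lt (c e : R) : 0 < e -> exists k, c * 2^-1 ^+ k < e.
Proof.
move=> e0; exists (Num.bound `|c / e|); set k := Num.bound _.
have h : c / e < 2 ^+ k.
  apply: (le_lt_trans (ler_norm _)); apply: (lt_trans (archi_boundP (normr_ge0 _))).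
  by rewrite -natrX ltr_nat ltn_expl.
by rewrite exprVn ltr_pdivrMr ?exprn_gt0// -ltr_pdivrMl// mulrC.
Qed.

Lemma half_expn_eq0 (a c : R) : (forall k, `|a| <= c * 2^-1 ^+ k) -> a = 0.
Proof.
move=> h; apply/eqP; rewrite -normr_le0 leNgt; apply/negP => a0.
by have [k] := half_expn_lt c a0; rewrite ltNge h.
Qed.

(** The tail of the geometric series bounds the distance to the limit, so the intervals of radius
    [2 * c * 2^-1 ^+ k] around [u k] are nested, and the supremum of their left ends lies in all of
    them. *)
Lemma half_expn_limit (u : nat -> R) (c : R) :
  (forall k, `|u k.+1 - u k| <= c * 2^-1 ^+ k) ->
  exists l, forall k, `|l - u k| <= 2 * c * 2^-1 ^+ k.
Proof.
move=> h.
pose a k := u k - 2 * c * 2^-1 ^+ k; pose b k := u k + 2 * c * 2^-1 ^+ k.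
have c0 : 0 <= c by have := h 0; rewrite expr0 mulr1; exact: le_trans.
have aS k : a k <= a k.+1.
  by have := h k; rewrite ler_norml /a exprS => /andP[]; lra.
have bS k : b k.+1 <= b k.
  by have := h k; rewrite ler_norml /b exprS => /andP[]; lra.
have ab k : a k <= b k.
  have : 0 <= 2 * c * 2^-1 ^+ k.
    by rewrite mulr_ge0 ?mulr_ge0// exprn_ge0// invr_ge0.
  by rewrite /a /b; lra.
have amono : {homo a : m n / (m <= n)%N >-> m <= n} by exact/nondecreasing_seqP.
have bmono : {homo b : m n / (m <= n)%N >-> n <= m} by exact/nonincreasing_seqP.
have abk j k : a j <= b k.
  apply: (le_trans (amono _ _ (leq_maxl j k))).
  by apply: (le_trans (ab _)); apply: bmono; exact: leq_maxr.
have ub : has_ubound (range a) by exists (b 0) => _ [j _ <-].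
exists (sup (range a)) => k; rewrite ler_norml; apply/andP; split.
  have : a k <= sup (range a) by apply: ub_le_sup => //; exists k.
  by rewrite /a; lra.
have : sup (range a) <= b k.
  by apply: ge_sup; [exists (a 0), 0%N|move=> _ [j _ <-]].
by rewrite /b; lra.
Qed.

(** The Lipschitz constant is uniform in time and space, so successive approximations converge on
    the whole line in a sup norm with exponential weight. The bound [B] along the constant curve
    [x0] controls the first increment. *)
Theorem picard_global (I : finType) (F : R -> (I -> R) -> I -> R) (L : R) :
  0 < L ->
  (forall t (x y : I -> R) d, (forall i, `|x i - y i| <= d) ->
    forall i, `|F t x i - F t y i| <= L * d) ->
  (forall X : R -> I -> R, (forall i, continuous (X^~ i)) ->
    forall i, continuous (fun t => F t (X t) i)) ->
  forall (x0 : I -> R) (B : R), (forall t i, `|F t x0 i| <= B) ->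
  exists X : R -> I -> R, X 0 = x0 /\
    forall t i, is_derive t 1 (X^~ i) (F t (X t) i).
Proof.
move=> L_gt0 F_lip F_cont x0 B FB.
(* [P f] is the antiderivative vanishing at 0 when [f] is continuous and arbitrary otherwise, so
   that [step] is defined on every curve. *)
have /choice[P PE] : forall f : R -> R, exists G : R -> R, continuous f ->
    G 0 = 0 /\ forall t, is_derive t 1 G (f t).
  move=> f; have [cf|ncf] := pselect (continuous f); last by exists f.
  by have [G GE] := continuous_antiderivative cf; exists G.
pose step (X : R -> I -> R) t i := x0 i + P (fun s => F s (X s) i) t.
have stepP X : (forall i, continuous (X^~ i)) ->
    forall i t, is_derive t 1 ((step X)^~ i) (F t (X t) i).
  move=> cX i t; have [_ /(_ t) dP] := PE _ (@F_cont X cX i).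
  exact: is_derive_eq (is_deriveD_fun (is_derive_cst_fun (x0 i) t) dP) (add0r _).
have step0 X : (forall i, continuous (X^~ i)) -> step X 0 = x0.
  move=> cX; apply/funext => i; rewrite /step.
  by have [-> _] := PE _ (@F_cont X cX i); rewrite addr0.
pose X k := iter k step (fun=> x0).
have cX k i : continuous ((X k)^~ i).
  elim: k i => [|k IH] i; first by move=> t; exact: cvg_cst.
  by move=> t; exact: is_derive_continuous (stepP _ IH i t).
(* The first increment has derivative at most [B]; integrated against the weight of rate [2 * L] it
   is at most [c] times the weight. *)
pose c := B / (2 * L).
have LL0 : 0 < 2 * L by rewrite mulr_gt0.
(* In the norm weighted by [E] the map [step] is a contraction with ratio 1/2. *)
pose E t := expR (2 * L * `|t|).
have lipE Y Z (h : R) : (forall i, continuous (Y^~ i)) -> (forall i, continuous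
    (Z^~ i)) ->
    (forall t i, `|Y t i - Z t i| <= h * E t) ->
    forall t i, `|step Y t i - step Z t i| <= h / 2 * E t.
  move=> cY cZ YZ t i.
  have -> : h / 2 = L * h / (2 * L).
    by field; rewrite gt_eqF.
  apply: (@expR_dominated (fun t => step Y t i - step Z t i)
    (fun t => F t (Y t) i - F t (Z t) i)) => //.
  - by rewrite !step0// subrr.
  - by move=> s; apply: is_deriveB_fun; apply: stepP.
  - by move=> s; rewrite -mulrA; exact: F_lip.
have dX k t i : `|X k.+1 t i - X k t i| <= c * E t * 2^-1 ^+ k.
  elim: k t i => [|k IH] t i.
    rewrite expr0 mulr1.
    apply: (@expR_dominated (fun t => X 1 t i - x0 i) (fun t => F t x0 i)) => //.
    - by rewrite /X /= step0 ?subrr//; move=> j s; exact: cvg_cst.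
    - move=> s; apply: is_derive_eq (subr0 _);
        apply: is_deriveB_fun (is_derive_cst_fun _ _).
      by apply: (stepP (fun=> x0)) => j u; exact: cvg_cst.
    - move=> s; apply: (le_trans (FB s i)).
      have B0 : 0 <= B by apply: le_trans (FB 0 i).
      rewrite ler_peMr//; apply: le_trans (expR_ge1Dx _).
      by rewrite lerDl mulr_ge0// ltW.
  have h s j : `|X k.+1 s j - X k s j| <= c * 2^-1 ^+ k * E s by rewrite mulrAC.
  have := lipE (X k.+1) (X k) (c * 2^-1 ^+ k) (cX _) (cX _) h t i.
  by move=> /le_trans; apply; rewrite exprSr; apply: eq_ler; ring.
have /choice[Y YE] : forall ti : R * I, exists l, forall k,
    `|l - X k ti.1 ti.2| <= 2 * (c * E ti.1) * 2^-1 ^+ k.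
  by move=> [t i]; apply: (half_expn_limit (u := fun k => X k t i)) => k; exact: dX.
pose Z t i := Y (t, i).
have ZX k t i : `|Z t i - X k t i| <= 2 * c * 2^-1 ^+ k * E t.
  by apply: (le_trans (YE (t, i) k)); apply: eq_ler; rewrite /=; ring.
(* Convergence is uniform on the unit neighbourhood of [t], where the weight is at most its value at
   [|t| + 1]; a three-epsilon argument follows. *)
have cZ i : continuous (Z^~ i).
  move=> t; apply/cvgrPdist_lt => e e0.
  have [k hk] := half_expn_lt (2 * c * expR (2 * L * (`|t| + 1))) (divr_gt0 e0
      (ltr0n R 3)).
  have near_le s : `|t - s| < 1 -> `|Z s i - X k s i| < e / 3.
    move=> ts; apply: le_lt_trans (ZX k s i) (le_lt_trans _ hk).
    rewrite mulrAC ler_wpM2r ?exprn_ge0 ?invr_ge0// ler_wpM2l//.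
      by rewrite mulr_ge0// /c divr_ge0 ?(ltW LL0)// (le_trans _ (FB 0 i)).
    rewrite ler_expR ler_wpM2l ?(ltW LL0)// -lerBlDl.
    apply: le_trans (ltW ts); rewrite distrC; apply: lerB_dist.
  near=> s.
  have ts : `|t - s| < 1 by near: s; exists 1 => //=.
  have Xts : `|X k t i - X k s i| < e / 3.
    near: s; have /cvgrPdist_lt := cX k i t; apply; exact: divr_gt0.
  have h1 := near_le _ ts; have := near_le t; rewrite subrr normr0 => /(_ ltr01) h2.
  have -> : Z t i - Z s i = (Z t i - X k t i) + (X k t i - X k s i) - (Z s i - X k
      s i).
    by ring.
  apply: (le_lt_trans (ler_normB _ _));
      apply: (@lt_le_trans _ _ (e / 3 + e / 3 + e / 3)).
    apply: ltrD h1; apply: le_lt_trans (ler_normD _ _) _; exact: ltrD.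
  by apply: eq_ler; field.
have stepZ : step Z = Z.
  apply/funext => t; apply/funext => i; apply/eqP; rewrite -subr_eq0; apply/eqP.
  apply: (@half_expn_eq0 _ (2 * c * E t)) => k.
  have h1 := lipE Z (X k) _ cZ (cX k) (ZX k) t i.
  have h2 := ZX k.+1 t i; rewrite exprS in h2.
  have -> : step Z t i - Z t i = (step Z t i - X k.+1 t i) - (Z t i - X k.+1 t i)
      by ring.
  apply: (le_trans (ler_normB _ _)); apply: (le_trans (lerD h1 h2)).
  by apply: eq_ler; field.
exists Z; split; first by rewrite -stepZ step0.
by move=> t i; have := stepP Z cZ i t; rewrite stepZ.
Unshelve. all: by end_near. Qed.

End Picard.

(** The sup norm is not differentiable, so the argument runs on the sum of squares [S], which
    satisfies [S' <= 2 n L S] with [n = #|I|]; hence [S(t) exp(- 2 n L t)] does not increase. The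
    factor [sqrt n] that results is weakened to [n]. *)
Lemma gronwall {R : realType} {I : finType} (D dD : R -> I -> R) (L T h : R) :
  0 <= L -> 0 <= h ->
  (forall (t : R) i, 0 <= t <= T -> is_derive t 1 (D^~ i) (dD t i)) ->
  (forall t d : R, 0 <= t <= T -> (forall i, `|D t i| <= d) ->
     forall i, `|dD t i| <= L * d) ->
  (forall i, `|D 0 i| <= h) ->
  forall (t : R) i, 0 <= t <= T -> `|D t i| <= h * (#|I|%:R * expR (#|I|%:R * L *
      t)).
Proof.
move=> L0 h0 DP DL D0 t i /andP[t0 tT].
pose n : R := #|I|%:R.
have n1 : 1 <= n by rewrite /n ler1n; apply/card_gt0P; exists i.
pose S s := \sum_j D s j ^+ 2.
have DS s j : `|D s j| <= Num.sqrt (S s).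
  rewrite -sqrtr_sqr; apply: ler_wsqrtr; rewrite /S (bigD1 j)//= lerDl.
  by apply: sumr_ge0 => k _; exact: sqr_ge0.
have S0 s : 0 <= S s by apply: sumr_ge0 => k _; exact: sqr_ge0.
pose a := - (2 * n * L).
have dS (s : R) : 0 <= s <= T -> is_derive s 1 S (\sum_j (2 * (D s j * dD s j))).
  move=> sT; apply: is_derive_sum_fun => j; have dj := DP s j sT.
  by apply: (is_derive_eq (is_deriveM_fun dj dj)); ring.
have SE : S t * expR (a * t) <= S 0 * expR (a * 0).
  apply: (is_derive_nincr (f := fun s => S s * expR (a * s)) (df := fun s =>
    (\sum_j (2 * (D s j * dD s j))) * expR (a * s) + S s * (a * expR (a * s)))) =>
        //.
    move=> s /andP[s0 st]; apply: is_deriveM_fun (dS s _) (is_derive_expRZ a s).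
    by rewrite s0 (le_trans st).
  move=> s /andP[s0 st].
  have sT : 0 <= s <= T by rewrite s0 (le_trans st).
  rewrite mulrA [S s * a]mulrC -mulrDl mulr_le0_ge0 ?expR_ge0// /a mulNr subr_le0.
  apply: (@le_trans _ _ (\sum_(j : I) (2 * L * S s))).
    apply: ler_sum => j _; rewrite -mulrA ler_wpM2l//.
    apply: (le_trans (ler_norm _)); rewrite normrM.
    have -> : L * S s = Num.sqrt (S s) * (L * Num.sqrt (S s)).
      by rewrite mulrCA -expr2 sqr_sqrtr.
    apply: ler_pM => //; exact: DL sT (DS s) j.
  by rewrite sumr_const -mulr_natl -/n; apply: eq_ler; ring.
have S00 : S 0 <= n * h ^+ 2.
  apply: (@le_trans _ _ (\sum_(j : I) h ^+ 2)).
    apply: ler_sum => j _; rewrite -real_normK ?num_real//.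
    by rewrite ler_sqr ?nnegrE.
  by rewrite sumr_const -mulr_natl.
have St : S t <= n * h ^+ 2 * expR (2 * n * L * t).
  move: SE; rewrite mulr0 expR0 mulr1 => /le_trans/(_ S00).
  by rewrite /a mulNr expRN -ler_pdivlMr ?invr_gt0 ?expR_gt0// invrK.
have r0 : 0 <= h * (n * expR (n * L * t)).
  by rewrite mulr_ge0// mulr_ge0 ?expR_ge0// (le_trans _ n1).
rewrite -(ler_sqr (x := `|_|)) ?nnegrE ?normr_ge0//.
apply: (@le_trans _ _ (S t)).
  by rewrite real_normK ?num_real// /S (bigD1 i)//= lerDl sumr_ge0// => k _;
      exact: sqr_ge0.
apply: (le_trans St); rewrite !exprMn -expRM_natl.
have -> : 2 * n * L * t = 2%:R * (n * L * t) by ring.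
set e := expR _; have -> : h ^+ 2 * (n ^+ 2 * e) = n ^+ 2 * h ^+ 2 * e by ring.
rewrite ler_wpM2r ?expR_ge0// ler_wpM2r ?sqr_ge0//.
by rewrite expr2 ler_peMl// (le_trans _ n1).
Qed.

(** * Bounded Lipschitz functions and autonomous systems *)

Section BoundedLipschitz.
Context {R : realType} {I : finType}.
Implicit Types (f g : (I -> R) -> R) (x y : I -> R) (c d : R).

(** Boundedness is carried along because products of unbounded Lipschitz functions need not be
    Lipschitz. The class is closed under the operations that build the cut-off field, inverses and
    square roots being taken of functions bounded below by a positive constant. *)
Definition bounded_lipschitz f := exists M L : R,
  [/\ 0 <= L, forall x, `|f x| <= M &
    forall x y d, (forall i, `|x i - y i| <= d) -> `|f x - f y| <= L * d].

Lemma bounded_lipschitz_cst c : bounded_lipschitz (fun=> c).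
Proof.
by exists `|c|, 0; split=> // x y d _; rewrite subrr normr0 mul0r.
Qed.

Lemma bounded_lipschitzD f g : bounded_lipschitz f -> bounded_lipschitz g ->
  bounded_lipschitz (fun x => f x + g x).
Proof.
move=> [M [L [L0 fM fL]]] [N [K [K0 gN gK]]]; exists (M + N), (L + K); split.
- exact: addr_ge0.
- by move=> x; apply: (le_trans (ler_normD _ _)); exact: lerD.
- move=> x y d xy; rewrite opprD addrACA mulrDl.
  by apply: (le_trans (ler_normD _ _)); apply: lerD; [exact: fL|exact: gK].
Qed.

Lemma bounded_lipschitzM f g : bounded_lipschitz f -> bounded_lipschitz g ->
  bounded_lipschitz (fun x => f x * g x).
Proof.
move=> [M [L [L0 fM fL]]] [N [K [K0 gN gK]]].
have M0 : 0 <= M := le_trans (normr_ge0 _) (fM (fun=> 0)).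
have N0 : 0 <= N := le_trans (normr_ge0 _) (gN (fun=> 0)).
exists (M * N), (L * N + M * K); split.
- by rewrite addr_ge0// mulr_ge0.
- by move=> x; rewrite normrM; exact: ler_pM.
- move=> x y d xy.
  have -> : f x * g x - f y * g y = (f x - f y) * g x + f y * (g x - g y) by ring.
  apply: (le_trans (ler_normD _ _)); rewrite !normrM mulrDl mulrAC -mulrA.
  apply: lerD.
    by rewrite mulrA; apply: ler_pM => //; rewrite ?fL ?gN.
  by rewrite -mulrA; apply: ler_pM => //; exact: gK.
Qed.

Lemma bounded_lipschitz_sum (J : finType) (F : J -> (I -> R) -> R) :
  (forall j, bounded_lipschitz (F j)) -> bounded_lipschitz (fun x => \sum_j F j x).
Proof.
move=> FB; elim: (index_enum J) => [|j r IH].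
  by under eq_fun do rewrite big_nil; exact: bounded_lipschitz_cst.
by under eq_fun do rewrite big_cons; exact: bounded_lipschitzD.
Qed.

Lemma bounded_lipschitz_comp (h : R -> R) (A : R) f (D : set R) :
  (forall u v, D u -> D v -> `|h u - h v| <= A * `|u - v|) -> 0 <= A ->
  (forall x, D (f x)) -> bounded_lipschitz f -> bounded_lipschitz (fun x => h (f
      x)).
Proof.
move=> hA A0 fD [M [L [L0 fM fL]]].
exists (`|h (f (fun=> 0))| + A * (M + M)), (A * L); split.
- exact: mulr_ge0.
- move=> x; rewrite -[h (f x)](subrK (h (f (fun=> 0)))) addrC.
  apply: (le_trans (ler_normD _ _)); rewrite lerD2l.
  apply: (le_trans (hA _ _ (fD _) (fD _))); rewrite ler_wpM2l//.
  by apply: (le_trans (ler_normB _ _)); exact: lerD.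
- move=> x y d xy; apply: (le_trans (hA _ _ (fD _) (fD _))).
  by rewrite -mulrA ler_wpM2l// fL.
Qed.

Lemma bounded_lipschitz_coord (h : R -> R) (M A : R) i : 0 <= A -> (forall u, `|h
    u| <= M) ->
  (forall u v, `|h u - h v| <= A * `|u - v|) -> bounded_lipschitz (fun x => h (x
      i)).
Proof.
move=> A0 hM hA; exists M, A; split=> // x y d xy.
by apply: (le_trans (hA _ _)); rewrite ler_wpM2l.
Qed.

Lemma maxr_lip (c u v : R) : `|Num.max u c - Num.max v c| <= `|u - v|.
Proof.
rewrite !maxEle; case: (leP u c) => uc; case: (leP v c) => vc; rewrite ler_norml;
  have := ler_norm (u - v); have := lerNnormlW (lexx `|u - v|); lra.
Qed.

Lemma minr_lip (c u v : R) : `|Num.min u c - Num.min v c| <= `|u - v|.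
Proof.
rewrite !minEle; case: (leP u c) => uc; case: (leP v c) => vc; rewrite ler_norml;
  have := ler_norm (u - v); have := lerNnormlW (lexx `|u - v|); lra.
Qed.

Lemma bounded_lipschitz_max f c : bounded_lipschitz f -> bounded_lipschitz (fun x
    => Num.max (f x) c).
Proof.
apply: (@bounded_lipschitz_comp (Num.max^~ c) 1 f setT) => // u v _ _.
by rewrite mul1r maxr_lip.
Qed.

Lemma bounded_lipschitzV f c : 0 < c -> (forall x, c <= f x) -> bounded_lipschitz
    f ->
  bounded_lipschitz (fun x => (f x)^-1).
Proof.
move=> c0 fc; apply: (@bounded_lipschitz_comp GRing.inv (c ^- 2) f [set u | c <=
    u]) => //.
  move=> u v /= cu cv.
  have u0 : 0 < u := lt_le_trans c0 cu.
  have v0 : 0 < v := lt_le_trans c0 cv.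
  have -> : u^-1 - v^-1 = (u * v)^-1 * (v - u) by field; rewrite !gt_eqF.
  rewrite normrM distrC ler_wpM2r// gtr0_norm ?invr_gt0 ?mulr_gt0//.
  by rewrite lef_pV2 ?posrE ?mulr_gt0 ?exprn_gt0// expr2 ler_pM// ltW.
by rewrite invr_ge0 exprn_ge0// ltW.
Qed.

Lemma bounded_lipschitz_sqrt f c : 0 < c -> (forall x, c ^+ 2 <= f x) ->
    bounded_lipschitz f ->
  bounded_lipschitz (fun x => Num.sqrt (f x)).
Proof.
move=> c0 fc; apply: (@bounded_lipschitz_comp Num.sqrt c^-1 f [set u | c ^+ 2 <=
    u]) => //.
  move=> u v /= cu cv.
  have csq z : c ^+ 2 <= z -> c <= Num.sqrt z.
    by move=> /ler_wsqrtr; rewrite sqrtr_sqr gtr0_norm.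
  have su := csq _ cu; have sv := csq _ cv.
  have ge0 z : c ^+ 2 <= z -> 0 <= z by apply: le_trans; exact: sqr_ge0.
  have -> : u - v = (Num.sqrt u + Num.sqrt v) * (Num.sqrt u - Num.sqrt v).
    by rewrite -[in LHS](sqr_sqrtr (ge0 _ cu)) -[in LHS](sqr_sqrtr (ge0 _ cv));
        ring.
  rewrite normrM mulrA ler_peMl// ler_pdivlMl// mulr1 ger0_norm; last by lra.
  by lra.
by rewrite invr_ge0 ltW.
Qed.

Lemma bounded_lipschitz_uniform (F : (I -> R) -> I -> R) :
  (forall i, bounded_lipschitz (F^~ i)) ->
  exists L, 0 < L /\ forall x y d, (forall i, `|x i - y i| <= d) ->
    forall i, `|F x i - F y i| <= L * d.
Proof.
move=> FB.
have /choice[L LE] : forall i, exists L, 0 <= L /\ forall x y d,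
    (forall i, `|x i - y i| <= d) -> `|F x i - F y i| <= L * d.
  by move=> i; have [M [L [L0 _ FL]]] := FB i; exists L.
have sL i : L i <= 1 + \sum_j L j.
  rewrite (bigD1 i)//= addrCA lerDl addr_ge0// sumr_ge0// => j _.
  by have [] := LE j.
exists (1 + \sum_j L j); split.
  by rewrite ltr_pwDl// sumr_ge0// => j _; have [] := LE j.
move=> x y d xy i; apply: (le_trans ((LE i).2 _ _ _ xy)).
rewrite ler_wpM2r//; exact: le_trans (xy i).
Qed.

Lemma picard_bounded_lipschitz (F : (I -> R) -> I -> R) (x0 : I -> R) :
  (forall i, bounded_lipschitz (F^~ i)) ->
  exists X : R -> I -> R, X 0 = x0 /\
    forall (t : R) i, is_derive t 1 (X^~ i) (F (X t) i).
Proof.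
move=> FB; have [L [L0 FL]] := bounded_lipschitz_uniform FB.
apply: (@picard_global R I (fun=> F) L L0 _ _ x0 (\sum_i `|F x0 i|)).
- by move=> _ x y d xy i; exact: FL.
- move=> X cX i t; apply/cvgrPdist_le => e e0.
  near=> s.
  have eL : L * (e / L) = e by field; rewrite gt_eqF.
  rewrite -eL; apply: FL; near: s.
  apply: filter_forall => j.
  have /cvgrPdist_le := cX j t; apply; exact: divr_gt0.
- by move=> _ i; rewrite (bigD1 i)//= lerDl sumr_ge0.
Unshelve. all: by end_near. Qed.

End BoundedLipschitz.

(** * The reference motion *)

Section Reference.
Context {R : realType}.
Implicit Types (s t u v : R).

Lemma cos_lip u v : `|cos u - cos v| <= `|u - v|.
Proof.
wlog uv : u v / u <= v => [H|].
  have [uv|uv] := leP u v; first exact: H.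
  by rewrite distrC (distrC u); apply: H; exact: ltW.
move: uv; rewrite le_eqVlt => /predU1P[->|uv]; first by rewrite !subrr.
have [c _ E] := MVT_is_derive uv (fun s _ => is_derive_cos s).
rewrite distrC E normrM normrN (distrC u) ler_piMl//.
by rewrite ler_norml sin_geN1 sin_le1.
Qed.

Lemma linear_oscillator (k : R -> R) (B : R) : continuous k ->
  (forall t, `|k t| <= B) ->
  exists mu nu : R -> R, [/\ mu 0 = 1, nu 0 = 0,
    forall t, is_derive t 1 mu (nu t) & forall t, is_derive t 1 nu (- k t * mu t)].
Proof.
move=> ck kB.
have B0 : 0 <= B := le_trans (normr_ge0 _) (kB 0).
(* The index [true] carries the position and [false] the velocity, so [b%:R] is the initial state
   [(1, 0)]. *)
pose F t (x : bool -> R) (b : bool) := if b then x false else - k t * x true.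
have [||||X [X0 XE]] := @picard_global R bool F (1 + B) _ _ _ (fun b => b%:R) (1 +
    B).
- by rewrite ltr_pwDl.
- move=> t x y d xy.
  have d0 : 0 <= d := le_trans (normr_ge0 _) (xy true).
  move=> []; first by apply: (le_trans (xy _)); rewrite mulrDl mul1r lerDl mulr_ge0.
  rewrite /F -mulrBr normrM normrN mulrDl mul1r [leRHS]addrC.
  apply: (@le_trans _ _ (B * d)); first by apply: ler_pM.
  by rewrite lerDl.
- move=> X cX [] t; first exact: cX.
  exact: (cvgM (cvgN (ck t)) (cX true t)).
- move=> t [] /=; first by rewrite normr0 addr_ge0.
  by rewrite mulr1 normrN (le_trans (kB t))// lerDr.
exists (X^~ true), (X^~ false); split.
- by rewrite X0.
- by rewrite X0.
- by move=> t; exact: XE t true.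
- by move=> t; exact: XE t false.
Qed.

(** This is the regularised time of the collapse: with [la = cos^2 ph] it reads [ph' = sg / la].
    Replacing [cos] by its maximum with [c] makes the equation globally Lipschitz. Since
    [ph' >= sg], the value [p] is reached by time [p / sg]. *)
Lemma cos_time_change (sg c p : R) : 0 < sg -> 0 < c -> c <= 1 -> 0 < p ->
  exists ph : R -> R, exists T, [/\ 0 < T, ph 0 = 0, ph T = p,
    forall t, is_derive t 1 ph (sg / Num.max (cos (ph t)) c ^+ 2) &
    forall s t, s < t -> ph s < ph t].
Proof.
move=> sg0 c0 c1 p0.
have mpos u : 0 < Num.max (cos u) c by rewrite lt_max c0 orbT.
pose F (x : unit -> R) (_ : unit) := sg / Num.max (cos (x tt)) c ^+ 2.
have FB i : bounded_lipschitz (F^~ i).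
  apply: bounded_lipschitzM; first exact: bounded_lipschitz_cst.
  apply: (@bounded_lipschitzV _ _ _ (c ^+ 2)); first exact: exprn_gt0.
    by move=> x; rewrite ler_sqr ?nnegrE ?(ltW c0) ?(ltW (mpos _))// le_max lexx
        orbT.
  have Bm : bounded_lipschitz (fun x : unit -> R => Num.max (cos (x tt)) c).
    apply: bounded_lipschitz_max;
        apply: (@bounded_lipschitz_coord _ _ _ 1 1) => // u.
      by rewrite ler_norml cos_geN1 cos_le1.
    by move=> v; rewrite mul1r cos_lip.
  exact: bounded_lipschitzM.
have [X [X0 XE]] := picard_bounded_lipschitz (fun=> 0) FB.
pose ph t := X t tt.
have phE t : is_derive t 1 ph (sg / Num.max (cos (ph t)) c ^+ 2) := XE t tt.
have ph0 : ph 0 = 0 by rewrite /ph X0.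
have dge t : sg <= sg / Num.max (cos (ph t)) c ^+ 2.
  rewrite ler_peMr ?(ltW sg0)// invf_ge1 ?exprn_gt0//.
  by rewrite exprn_ile1 ?(ltW (mpos _))// ge_max cos_le1 c1.
have mono (a b : R) : a < b -> ph a < ph b.
  move=> ab; have [d _ E] := MVT_is_derive ab (fun s _ => phE s).
  by rewrite -subr_gt0 E mulr_gt0 ?subr_gt0// (lt_le_trans sg0 (dge d)).
have large : p <= ph (p / sg).
  have ps : 0 <= p / sg by rewrite divr_ge0// ltW.
  have := @is_derive_le_diff R (fun s => sg * s) ph (fun=> sg) _ _ _ ps
    (fun s _ => is_derive_eq (is_deriveZ_fun sg (is_derive_id s 1)) (mulr1 sg))
        (fun s _ => phE s).
  rewrite mulr0 subr0 ph0 subr0 [sg * (p / sg)]mulrC divfK ?gt_eqF//;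
      apply => s _; exact: dge.
have cph : continuous ph by move=> t; exact: is_derive_continuous (phE t).
have [|||T /andP[T0 _] TE] := @IVT_zero R (fun s => ph s - p) 0 (p / sg).
- by move=> t; apply: continuousB; [exact: cph|exact: cvg_cst].
- by rewrite divr_ge0// ltW.
- by rewrite ph0 sub0r oppr_le0 (ltW p0) subr_ge0.
have phT : ph T = p by apply/eqP; rewrite -subr_eq0 TE.
exists ph, T; split=> //.
by rewrite lt_neqAle T0 andbT; apply: contraTneq p0 => T00;
    rewrite -phT -T00 ph0 ltxx.
Qed.


Lemma reference_motion (w K : R) : 0 < w -> w < K ->
  exists T (la dla mu dmu : R -> R), [/\ 0 < T,
    [/\ la 0 = 1, dla 0 = 0, mu 0 = 1 & dmu 0 = 0], mu T < 0 &
    forall t, 0 <= t <= T -> [/\ 0 < la t,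
      is_derive t 1 la (dla t), is_derive t 1 dla (- w / la t ^+ 2),
      is_derive t 1 mu (dmu t) & is_derive t 1 dmu (- K * mu t / la t ^+ 3)]].
Proof.
move=> w0 wK.
pose nu := Num.sqrt (2 * K / w - 1).
have nu2 : nu ^+ 2 = 2 * K / w - 1.
  by rewrite sqr_sqrtr// subr_ge0 ler_pdivlMr//; lra.
have nu1 : 1 < nu.
  rewrite -(ltr_sqr (x := 1)) ?nnegrE ?sqrtr_ge0// nu2 expr1n.
  by rewrite ltrBrDr ltr_pdivlMr//; lra.
have nu0 : 0 < nu by lra.
(* From [la = cos^2 ph] and [ph' = sg / la] one gets [la'' = - 2 sg^2 / la^2], whence
   [sg^2 = w / 2]. *)
pose sg := Num.sqrt (w / 2).
have sg0 : 0 < sg by rewrite sqrtr_gt0 divr_gt0.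
have sg2 : sg ^+ 2 = w / 2 by rewrite sqr_sqrtr// divr_ge0// ltW.
(* The first positive zero of [cos (nu * phi)], which precedes the collapse because [nu > 1]. *)
pose p := pi / 2 / nu.
have p0 : 0 < p by rewrite divr_gt0// divr_gt0// pi_gt0.
have ppi : p < pi / 2.
  by rewrite ltr_pdivrMr// ltr_pMr// divr_gt0// pi_gt0.
(* Strictly below [cos ph] as long as [ph <= p], so the cutoff is inactive on [[0, T]]. *)
pose c := cos p / 2.
have cosp0 : 0 < cos p by apply: cos_gt0_pihalf; rewrite ppi andbT;
    have := pi_gt0 R; lra.
have c0 : 0 < c by rewrite divr_gt0.
have c1 : c <= 1 by have := cos_le1 p; rewrite /c; lra.
have [ph [T [T0 ph0 phT dph mono]]] := cos_time_change sg0 c0 c1 p0.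
have phle s t : s <= t -> ph s <= ph t.
  by rewrite le_eqVlt => /predU1P[->//|/mono/ltW].
have phI t : 0 <= t <= T -> 0 <= ph t <= p.
  move=> /andP[t0 tT]; apply/andP; split; first by rewrite -ph0 phle.
  by rewrite -phT phle.
have cosI t : 0 <= t <= T -> c < cos (ph t).
  move=> /phI /andP[h0 hp]; apply: (@lt_le_trans _ _ (cos p));
      first by rewrite /c; lra.
  move: hp; rewrite le_eqVlt => /predU1P[->//|hp].
  by apply: ltW; rewrite ltr_cos// in_itv /=; apply/andP; split; have := pi_gt0 R;
      lra.
have cosp t : 0 <= t <= T -> 0 < cos (ph t) by move=> /cosI; exact: lt_trans.
have dph0 := dph; have {}dph t : 0 <= t <= T -> is_derive t 1 ph (sg / cos (ph t)
    ^+ 2).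
  by move=> /cosI h; have := dph t; rewrite max_l ?ltW.
pose m t := Num.max (cos (ph t)) c.
(* On [[0, T]], [m] is the square root of [la], hence the sixth power for [la^3]. *)
pose k t := K / m t ^+ 6.
have m0 t : c <= m t by rewrite /m le_max lexx orbT.
have kB t : `|k t| <= K / c ^+ 6.
  rewrite ger0_norm; last by rewrite divr_ge0 ?(ltW (lt_trans w0 wK))//
      exprn_ge0// (le_trans (ltW c0)).
  rewrite ler_pM2l ?(lt_trans w0)// lef_pV2 ?posrE ?exprn_gt0 ?(lt_le_trans c0)//.
  by rewrite lerXn2r ?nnegrE ?(ltW c0)// (le_trans (ltW c0)).
have cph : continuous ph by move=> t; exact: is_derive_continuous (dph0 t).
have ck : continuous k.
  move=> t; apply: cvgM; first exact: cvg_cst.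
  apply: cvgV; first by rewrite gt_eqF// exprn_gt0// (lt_le_trans c0).
  apply: (continuous_comp (f := m) (g := fun x => x ^+ 6));
      last exact: exprn_continuous.
  apply: continuous_max; last exact: cvg_cst.
  by apply: (continuous_comp (f := ph)); [exact: cph|exact: continuous_cos].
have [mu [dmu [mu0 dmu0 muE dmuE]]] := linear_oscillator ck kB.
pose C t := cos (ph t); pose S t := sin (ph t).
pose g t := cos (nu * ph t); pose h t := sin (nu * ph t).
have dC t : 0 <= t <= T -> is_derive t 1 C (- S t * (sg / C t ^+ 2)).
  by move=> tT; exact: is_derive_comp_fun (is_derive_cos _) (dph t tT).
have dS t : 0 <= t <= T -> is_derive t 1 S (C t * (sg / C t ^+ 2)).
  by move=> tT; exact: is_derive_comp_fun (is_derive_sin _) (dph t tT).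
have dg t : 0 <= t <= T -> is_derive t 1 g (- h t * (nu * (sg / C t ^+ 2))).
  by move=> tT; exact: is_derive_comp_fun (is_derive_cos _) (is_deriveZ_fun nu
      (dph t tT)).
have dh t : 0 <= t <= T -> is_derive t 1 h (g t * (nu * (sg / C t ^+ 2))).
  by move=> tT; exact: is_derive_comp_fun (is_derive_sin _) (is_deriveZ_fun nu
      (dph t tT)).
have CS t : C t ^+ 2 + S t ^+ 2 - 1 = 0 by rewrite cos2Dsin2 subrr.
have wE : w = 2 * sg ^+ 2 by rewrite sg2; field.
have KE : K = sg ^+ 2 * (nu ^+ 2 + 1) by rewrite sg2 nu2; field; rewrite gt_eqF.
have {}dmuE t : 0 <= t <= T -> is_derive t 1 dmu (- (K / C t ^+ 6) * mu t).
  by move=> tT; have := dmuE t; rewrite /k /m max_l// ltW// cosI.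
(* The Wronskian of [mu] and [cos ph * cos (nu * ph)]; the latter solves
   [chi'' = - w (1 + (K / w - 1) la) chi / la^3], where [la <= 1] makes the
   coefficient at most the [K / la^3] of [mu]. *)
pose Om t := dmu t * (C t * g t) +
  mu t * (sg * (S t * g t * (C t * C t)^-1 + nu * (h t * (C t)^-1))).
pose dOm t := - ((K - w) * (C t * g t) * S t ^+ 2 / C t ^+ 6) * mu t.
have OmE t : 0 <= t <= T -> is_derive t 1 Om (dOm t).
  move=> tT; have C0 : C t != 0 by rewrite gt_eqF// cosp.
  have CC0 : C t * C t != 0 by rewrite mulf_neq0.
  have dV1 := is_deriveV_fun (f := fun s => C s * C s) CC0 (is_deriveM_fun (dC t
      tT) (dC t tT)).
  have dV2 := is_deriveV_fun (f := C) C0 (dC t tT).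
  have d1 := is_deriveM_fun (is_deriveM_fun (dS t tT) (dg t tT)) dV1.
  have d2 := is_deriveZ_fun nu (is_deriveM_fun (dh t tT) dV2).
  have d3 := is_deriveM_fun (muE t) (is_deriveZ_fun sg (is_deriveD_fun d1 d2)).
  have d4 := is_deriveM_fun (dmuE t tT) (is_deriveM_fun (dC t tT) (dg t tT)).
  apply: (is_derive_eq (is_deriveD_fun d4 d3)).
  apply/eqP; rewrite -subr_eq0; apply/eqP.
  transitivity (mu t * g t * sg ^+ 2 * (1 + nu ^+ 2) / C t ^+ 5 * (C t ^+ 2 + S t
      ^+ 2 - 1));
    last by rewrite CS mulr0.
  rewrite /dOm KE wE; move: (C t) (S t) (g t) (h t) (mu t) (dmu t) C0.
  by move=> C' S' g' h' mu' dmu' C'0; field.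
have C_gt0 t : 0 <= t <= T -> 0 < C t by exact: cosp.
have g_ge0 t : 0 <= t <= T -> 0 <= g t.
  move=> /phI /andP[h0 hp]; apply: cos_ge0_pihalf.
  have : nu * ph t <= nu * p by rewrite ler_pM2l.
  have -> : nu * p = pi / 2 by rewrite /p; field; rewrite gt_eqF.
  by move=> ->; rewrite andbT (@le_trans _ _ 0) ?mulr_ge0 ?(ltW nu0)// oppr_le0
      divr_ge0// pi_ge0.
have g_gt0 t : 0 < t < T -> 0 < g t.
  move=> /andP[t0 tT]; apply: cos_gt0_pihalf.
  have : nu * ph t < nu * p by rewrite ltr_pM2l// -phT mono.
  have -> : nu * p = pi / 2 by rewrite /p; field; rewrite gt_eqF.
  move=> ->; rewrite andbT (@lt_le_trans _ _ 0) ?mulr_ge0 ?(ltW nu0)//.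
    by rewrite oppr_lt0 divr_gt0// pi_gt0.
  by rewrite -ph0 phle// ltW.
have S_gt0 t : 0 < t < T -> 0 < S t.
  move=> /andP[t0 tT]; apply: sin_gt0_pihalf; rewrite -{1}ph0 mono//=.
  by apply: lt_trans ppi; rewrite -phT mono.
(* If [mu] stayed nonnegative, the Wronskian would start at 0, become negative while [mu] is still
   positive, and not increase afterwards. At [T], however, [g = 0] and [h = 1] leave
   [mu T * sg * nu / C T], which would be nonnegative. *)
have [T' /andP[T'0 T'T] muT'] : exists2 t, 0 < t <= T & mu t < 0.
  apply: contrapT => none.
  have muge t : 0 <= t <= T -> 0 <= mu t.
    move=> /andP[]; rewrite le_eqVlt => /predU1P[<- _|t0 tT]; first by rewrite mu0.
    by rewrite leNgt; apply/negP => mut; apply: none; exists t; rewrite ?t0.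
  have [t1 /andP[t10 t1T] mupos] : exists2 t1, 0 < t1 <= T &
      forall s, 0 <= s <= t1 -> 0 < mu s.
    have /cvgrPdist_lt/(_ 1 ltr01)[d /= d0 dP] := is_derive_continuous (muE 0).
    exists (Num.min (d / 2) T);
        first by rewrite lt_min divr_gt0// T0 ge_min lexx orbT.
    move=> s /andP[s0]; rewrite le_min => /andP[sd _].
    have := dP s; rewrite /= sub0r normrN (ger0_norm s0) mu0.
    have sd' : s < d by move: d0 sd; lra.
    by move=> /(_ sd'); rewrite ltr_norml => /andP[_]; lra.
  have [e /andP[e0 et1] Oe] := MVT_is_derive t10
    (fun s h => OmE s (introT andP (conj (andP h).1 (le_trans (andP h).2 t1T)))).
  have eT : 0 < e < T by rewrite e0 (lt_le_trans et1).
  have eT' : 0 <= e <= T by have /andP[??] := eT; rewrite !ltW.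
  have S0 : S 0 = 0 by rewrite /S ph0 sin0.
  have h0 : h 0 = 0 by rewrite /h ph0 mulr0 sin0.
  have Om0 : Om 0 = 0 by rewrite /Om dmu0 S0 h0; ring.
  have Om1 : Om t1 < 0.
    move: Oe; rewrite Om0 !subr0 => ->; rewrite pmulr_llt0// /dOm mulNr oppr_lt0.
    rewrite mulr_gt0//; last by apply: mupos; rewrite !ltW.
    rewrite divr_gt0 ?exprn_gt0 ?C_gt0// !mulr_gt0 ?exprn_gt0 ?subr_gt0 ?C_gt0
        ?g_gt0 ?S_gt0//.
  have OmT : Om T <= Om t1.
    have sT (s : R) : t1 <= s <= T -> 0 <= s <= T.
      by move=> /andP[t1s ->]; rewrite andbT (le_trans (ltW t10)).
    apply: (is_derive_nincr t1T (fun s h => OmE s (sT s h))) => s /sT sT'.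
    rewrite /dOm mulNr oppr_le0 mulr_ge0 ?muge//.
    have Kw : 0 <= K - w by rewrite subr_ge0 ltW.
    have Ct := ltW (C_gt0 _ sT').
    by apply: divr_ge0; [apply: mulr_ge0 (sqr_ge0 _); apply: mulr_ge0 Kw _;
      apply: mulr_ge0 Ct _; exact: g_ge0|exact: exprn_ge0].
  have TT : 0 <= T <= T by rewrite lexx ltW.
  have gT : g T = 0.
    by rewrite /g phT (_ : nu * p = pi / 2) ?cos_pihalf// /p; field; rewrite gt_eqF.
  have hT : h T = 1.
    by rewrite /h phT (_ : nu * p = pi / 2) ?sin_pihalf// /p; field; rewrite gt_eqF.
  have : 0 <= Om T; last by move: OmT Om1; lra.
  rewrite /Om gT hT !(mulr0, mul0r, add0r, mul1r) mulr_ge0 ?muge//.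
  by rewrite !mulr_ge0 ?invr_ge0 ?(ltW sg0) ?(ltW nu0) ?(ltW (C_gt0 _ TT)).
have T'I t : 0 <= t <= T' -> 0 <= t <= T.
  by move=> /andP[-> /le_trans]; apply.
have C00 : C 0 = 1 by rewrite /C ph0 cos0.
exists T', (fun t => C t * C t), (fun t => - (2 * sg) * (S t * (C t)^-1)), mu, dmu.
split; [exact: T'0| |exact: muT'|].
  by split; rewrite ?C00 ?/S ?ph0 ?sin0 ?mul1r ?mul0r ?mulr0.
move=> t /T'I tT; have C0 : C t != 0 by rewrite gt_eqF// C_gt0.
split.
- by rewrite mulr_gt0// C_gt0.
- by apply: (is_derive_eq (is_deriveM_fun (dC t tT) (dC t tT)));
    move: (C t) (S t) C0 => x y x0; field.
- apply: (is_derive_eq (is_deriveZ_fun (- (2 * sg)) (is_deriveM_fun (dS t tT)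
    (is_deriveV_fun (f := C) C0 (dC t tT))))).
  apply/eqP; rewrite -subr_eq0; apply/eqP.
  transitivity (- 2 * sg ^+ 2 / C t ^+ 4 * (C t ^+ 2 + S t ^+ 2 - 1));
    last by rewrite CS mulr0.
  by rewrite wE; move: (C t) (S t) C0 => x y x0; field.
- exact: muE.
- apply: (is_derive_eq (dmuE t tT)); rewrite mulNr mulNr.
  by move: (C t) C0 => x x0; field.
Qed.

End Reference.

(** * Euler configurations *)

Definition i0 : 'I_3 := @Ordinal 3 0 isT.
Definition i1 : 'I_3 := @Ordinal 3 1 isT.
Definition i2 : 'I_3 := @Ordinal 3 2 isT.

Lemma ord3_ind (P : 'I_3 -> Prop) : P i0 -> P i1 -> P i2 -> forall i, P i.
Proof.
move=> P0 P1 P2 [[|[|[|//]]] lt]; rewrite (bool_irrelevance lt isT) //.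
Qed.

Lemma sum3 (V : nmodType) (F : 'I_3 -> V) : \sum_i F i = F i0 + F i1 + F i2.
Proof.
rewrite !big_ord_recl big_ord0 addr0 addrA.
by congr (F _ + F _ + F _); apply: val_inj.
Qed.

(** The equation for [a] is that of a collinear central configuration. It also says that [a] is an
    eigenvector, with value [w], of the linear operator governing transverse displacements; [b] is
    an eigenvector with the larger value [K]. The last inequality makes [b] independent of [a] and
    of the translations, and fixes its sign. *)
Definition euler_configuration (R : realType) (m a b : 'I_3 -> R) (w K : R) :=
  [/\ 0 < w < K, a i0 < a i1 < a i2,
   \sum_i m i * a i = 0 /\ \sum_i m i * b i = 0,
   (forall i, \sum_j m j * (a j - a i) / `|a j - a i| ^+ 3 = - w * a i) /\
   (forall i, \sum_j m j * (b j - b i) / `|a j - a i| ^+ 3 = - K * b i) &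
   0 < (a i1 - a i0) * (b i2 - b i0) - (a i2 - a i0) * (b i1 - b i0)].

Section Euler.
Context {R : realType}.

(** Place the bodies at distances [x] and 1. The equation says that the relative acceleration of the
    first two is [x] times that of the last two, so that the shape is preserved; clearing
    denominators gives Euler's quintic [p], negative at 0. *)
Lemma euler_gap (m0 m1 m2 : R) : 0 < m0 -> 0 < m1 -> 0 < m2 ->
  exists2 x, 0 < x & (m0 + m1) / x ^+ 2 + m2 / (x + 1) ^+ 2 - m2 =
    x * (m1 + m2 + m0 / (x + 1) ^+ 2 - m0 / x ^+ 2).
Proof.
move=> m00 m10 m20.
(* Chosen so that [(m1 + m2) * N >= 3 * m0 + m1]: of this, [m0 + m1] absorbs the first negative term
   of [p], and [2 * m0] the second, as [N (1 + 2 N) <= 2 (N + 1)^2]. *)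
pose N := (3 * m0 + m1) / (m1 + m2) + 1.
have N1 : 1 <= N by rewrite lerDr divr_ge0; lra.
pose p (x : R) := m2 * (x * x) * (x * (x + 2)) + (m1 + m2) * (x * x * x) * ((x +
    1) * (x + 1))
  - (m0 + m1) * ((x + 1) * (x + 1)) - m0 * x * (1 + 2 * x).
have [|||x /andP[x0 xN] px] := @IVT_zero R p 0 N.
- pose P : {poly R} := m2%:P * ('X * 'X) * ('X * ('X + 2%:P))
    + (m1 + m2)%:P * ('X * 'X * 'X) * (('X + 1) * ('X + 1))
    - (m0 + m1)%:P * (('X + 1) * ('X + 1)) - m0%:P * 'X * (1 + 2%:P * 'X).
  have -> : p = horner P by apply/funext => x; rewrite /P /p !hornerE; ring.
  exact: continuous_horner.
- by lra.
- apply/andP; split; first by rewrite /p; lra.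
  have Nm : (m1 + m2) * N = 3 * m0 + m1 + (m1 + m2).
    by rewrite /N; field; lra.
  have N2 : 0 <= m2 * N ^+ 2 * (N * (N + 2)).
    by rewrite !mulr_ge0 ?sqr_ge0//; lra.
  have N3 : (3 * m0 + m1) * (N + 1) ^+ 2 <= (m1 + m2) * N ^+ 3 * (N + 1) ^+ 2.
    rewrite ler_wpM2r ?sqr_ge0//; apply: (@le_trans _ _ ((m1 + m2) * N));
        first by lra.
    by rewrite ler_wpM2l; [| |rewrite exprSr ler_peMl ?exprn_ege1//]; lra.
  have N4 : m0 * (N * (1 + 2 * N)) <= m0 * (2 * (N + 1) ^+ 2).
    by rewrite ler_wpM2l; [| |]; nra.
  by rewrite /p; nra.
have xn0 : 0 < x.
  rewrite lt_neqAle x0 andbT; apply/eqP => x00; move: px.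
  by rewrite -x00 /p; lra.
exists x => //; apply/eqP; rewrite -subr_eq0; apply/eqP.
transitivity (- p x / (x ^+ 2 * (x + 1) ^+ 2)); last by rewrite px oppr0 mul0r.
by rewrite /p; field; rewrite !gt_eqF; lra.
Qed.

Lemma euler_exists (m : 'I_3 -> R) : (forall i, 0 < m i) ->
  exists a b w K, euler_configuration m a b w K.
Proof.
move=> m_gt0; have [x x0 xE] := euler_gap (m_gt0 i0) (m_gt0 i1) (m_gt0 i2).
move: (m_gt0 i0) (m_gt0 i1) (m_gt0 i2) xE.
set m0 := m i0; set m1 := m i1; set m2 := m i2 => m00 m10 m20 xE.
pose M := m0 + m1 + m2; have M0 : 0 < M by rewrite !addr_gt0.
(* Puts the center of mass of [a0, a0 + x, a0 + x + 1] at 0. *)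
pose a0 := - (m1 * x + m2 * (x + 1)) / M.
pose a (i : 'I_3) := nth 0 [:: a0; a0 + x; a0 + x + 1] i.
(* [b] is orthogonal to [1] and to [a] for the inner product weighted by [m]. *)
pose b (i : 'I_3) := nth 0 [:: 1 / m0; - (x + 1) / m1; x / m2] i.
(* [w] is the relative acceleration across the unit gap between bodies 2 and 3, and [K] is read off
   from the eigenvector equation of body 3. The equations for the other two bodies then rely on
   [xE]. *)
pose w := m1 + m2 + m0 / (x + 1) ^+ 2 - m0 / x ^+ 2.
pose K := m0 / (x + 1) ^+ 3 + m1 + m2 / x * (x + 1 - 1 / (x + 1) ^+ 3).
have x10 : 0 < x + 1 by lra.
(* The definition of [w] contains a difference; the relative acceleration of the two outer bodies,
   divided by their distance [x + 1], has only positive terms. *)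
have wE : w = (m1 / x ^+ 2 + (m0 + m2) / (x + 1) ^+ 2 + m1) / (x + 1).
  have -> : m1 / x ^+ 2 + (m0 + m2) / (x + 1) ^+ 2 + m1 = x * w + w.
    by rewrite -xE /w; field; rewrite !gt_eqF.
  by field; rewrite gt_eqF.
have w0 : 0 < w.
  by rewrite wE divr_gt0// !addr_gt0// divr_gt0 ?exprn_gt0// addr_gt0.
have wK : w < K.
  have -> : K = w + (m0 * (1 / x ^+ 2 - 1 / (x + 1) ^+ 2) + m0 / (x + 1) ^+ 3
     + m2 / x * (1 - 1 / (x + 1) ^+ 3)).
    by rewrite /K /w; field; rewrite !gt_eqF.
  rewrite ltrDl !addr_gt0//.
  - by rewrite mulr_gt0// subr_gt0 !div1r ltf_pV2 ?posrE ?exprn_gt0// ltr_sqr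
      ?nnegrE; lra.
  - by rewrite divr_gt0// exprn_gt0.
  - by rewrite mulr_gt0 ?divr_gt0// subr_gt0 div1r invf_lt1 ?exprn_gt0//
      exprn_egt1// ltrDr.
exists a, b, w, K; split.
- by rewrite w0.
- by rewrite /a /=; lra.
- split; rewrite sum3 /a /b /= -/m0 -/m1 -/m2 ?/a0 ?/M; field; rewrite ?gt_eqF//.
- have E01 : a0 + x - a0 = x by ring.
  have E10 : a0 - (a0 + x) = - x by ring.
  have E02 : a0 + x + 1 - a0 = x + 1 by ring.
  have E20 : a0 - (a0 + x + 1) = - (x + 1) by ring.
  have E12 : a0 + x + 1 - (a0 + x) = 1 by ring.
  have E21 : a0 + x - (a0 + x + 1) = - 1 by ring.
  have dE := (E01, E10, E02, E20, E12, E21, normrN, gtr0_norm x0, gtr0_norm x10,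
    normr1, subrr, mulr0, mul0r, addr0, add0r).
  have x_neq0 : x != 0 by rewrite gt_eqF.
  have x1_neq0 : x + 1 != 0 by rewrite gt_eqF.
  have m0_neq0 : m0 != 0 by rewrite gt_eqF.
  have m1_neq0 : m1 != 0 by rewrite gt_eqF.
  have m2_neq0 : m2 != 0 by rewrite gt_eqF.
  have M_neq0 : M != 0 by rewrite gt_eqF.
  have f0E : m1 / x ^+ 2 + m2 / (x + 1) ^+ 2 = - w * a0.
    apply: (mulfI M_neq0); transitivity (m1 * (x * w) + m2 * (x * w + w)).
      by rewrite -xE /w /M; field;
          rewrite ?x_neq0 ?x1_neq0 ?m0_neq0 ?m1_neq0 ?m2_neq0.
    by rewrite /a0; field; exact: M_neq0.
  split; apply: ord3_ind; rewrite sum3 /a /b /= -/m0 -/m1 -/m2 !dE.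
  + by rewrite -f0E; field; rewrite ?x_neq0 ?x1_neq0 ?m0_neq0 ?m1_neq0 ?m2_neq0.
  + have -> : - w * (a0 + x) = - w * a0 - x * w by ring.
    by rewrite -f0E -xE; field; rewrite ?x_neq0 ?x1_neq0 ?m0_neq0 ?m1_neq0 ?m2_neq0.
  + have -> : - w * (a0 + x + 1) = - w * a0 - x * w - w by ring.
    by rewrite -f0E -xE /w; field;
        rewrite ?x_neq0 ?x1_neq0 ?m0_neq0 ?m1_neq0 ?m2_neq0.
  + apply/eqP; rewrite -subr_eq0; apply/eqP.
    transitivity (- ((m0 + m1) / x ^+ 2 + m2 / (x + 1) ^+ 2 - m2 - x * w) / (x *
        m0)).
      by rewrite /K /w; field; rewrite ?x_neq0 ?x1_neq0 ?m0_neq0 ?m1_neq0 ?m2_neq0.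
    by rewrite xE subrr oppr0 mul0r.
  + apply/eqP; rewrite -subr_eq0; apply/eqP.
    transitivity (((m0 + m1) / x ^+ 2 + m2 / (x + 1) ^+ 2 - m2 - x * w) / (x * m1)).
      by rewrite /K /w; field; rewrite ?x_neq0 ?x1_neq0 ?m0_neq0 ?m1_neq0 ?m2_neq0.
    by rewrite xE subrr mul0r.
  + by rewrite /K /w; field; rewrite ?x_neq0 ?x1_neq0 ?m0_neq0 ?m1_neq0 ?m2_neq0.
- rewrite /a /b /=.
  have -> : (a0 + x - a0) * (x / m2 - 1 / m0) - (a0 + x + 1 - a0) * (- (x + 1) /
      m1 - 1 / m0) =
    x ^+ 2 / m2 + (x + 1) ^+ 2 / m1 + 1 / m0 by field; rewrite !gt_eqF.
  by rewrite !addr_gt0// divr_gt0 ?exprn_gt0.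
Qed.
End Euler.

(** * Newton's equations as a first-order system *)

Lemma ord2_ind (P : 'I_2 -> Prop) : P 0 -> P 1 -> forall k, P k.
Proof.
move=> P0 P1 [[|[|//]] lt].
  by have -> : Ordinal lt = 0 by apply: val_inj.
by have -> : Ordinal lt = 1 by apply: val_inj.
Qed.

Lemma sum2 (V : nmodType) (F : 'I_2 -> V) : \sum_k F k = F 0 + F 1.
Proof.
rewrite !big_ord_recl big_ord0 addr0.
by congr (F _ + F _); apply: val_inj.
Qed.

Section Gradient.
Context {R : realType}.
Implicit Types (m : 'I_3 -> R) (q : config R).

Lemma enormE (u : 'rV[R]_2) : enorm u = Num.sqrt (u 0 0 ^+ 2 + u 0 1 ^+ 2).
Proof. by rewrite /enorm sum2. Qed.

Lemma enorm_gt0 (u : 'rV[R]_2) : u != 0 -> 0 < enorm u.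
Proof.
move=> u0; rewrite enormE sqrtr_gt0 lt_neqAle addr_ge0 ?sqr_ge0// andbT eq_sym.
apply: contra u0; rewrite paddr_eq0 ?sqr_ge0// !sqrf_eq0 => /andP[/eqP u0 /eqP u1].
by apply/eqP/rowP; apply: ord2_ind; rewrite mxE.
Qed.

Lemma enormN (u : 'rV[R]_2) : enorm (- u) = enorm u.
Proof. by rewrite !enormE !mxE !sqrrN. Qed.

(** Reduces partial derivatives to the one-variable calculus above. *)
Lemma derive_along (V : normedModType R) (f : V -> R) (a v : V) :
  'D_v f a = 'D_1 (fun h : R => f (h *: v + a)) 0.
Proof.
rewrite /derive; set F := (fun h => _); set G := (fun h => h^-1 *: _).
suff -> : F = G by [].
by apply/funext => h; rewrite /F /G /= addr0 scale0r add0r [h *: 1]mulr1.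
Qed.

Lemma is_derive_inv_dist (x y c d : R) : 0 < x ^+ 2 + y ^+ 2 ->
  is_derive (0 : R) 1
    (fun h => (Num.sqrt ((h * c + x) ^+ 2 + (h * d + y) ^+ 2))^-1)
    (- (x * c + y * d) / Num.sqrt (x ^+ 2 + y ^+ 2) ^+ 3).
Proof.
move=> xy.
have dl (u w : R) : is_derive (0 : R) 1 (fun h => (h * u + w) ^+ 2) (2 * w * u).
  have d1 : is_derive (0 : R) 1 (fun h => h * u + w) u.
    have did : is_derive (0 : R) 1 (fun h : R => h) 1 := is_derive_id _ _.
    apply: (is_derive_eq (is_deriveD_fun (is_deriveM_fun did (is_derive_cst_fun u
        _)) (is_derive_cst_fun w _))).
    by rewrite mul1r mulr0 !addr0.
  have -> : (fun h : R => (h * u + w) ^+ 2) = (fun h => (h * u + w) * (h * u + w)).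
    by apply/funext => h; rewrite expr2.
  by apply: (is_derive_eq (is_deriveM_fun d1 d1)); ring.
pose S h := (h * c + x) ^+ 2 + (h * d + y) ^+ 2.
have S0 : S 0 = x ^+ 2 + y ^+ 2 by rewrite /S !mul0r !add0r.
have dS := is_deriveD_fun (dl c x) (dl d y).
have Sp : 0 < S 0 by rewrite S0.
have dq := @is_derive_comp_fun R Num.sqrt S 0 _ _ (is_derive1_sqrt Sp) dS.
have q0 : Num.sqrt (S 0) != 0 by rewrite gt_eqF// sqrtr_gt0.
apply: (is_derive_eq (@is_deriveV_fun R (fun h => Num.sqrt (S h)) 0 _ q0 dq)).
by rewrite S0 in q0 *; field.
Qed.

Lemma is_derive_inv_dist_row q (i p r : 'I_3) (k : 'I_2) : row p q != row r q ->
  is_derive (0 : R) 1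
    (fun h => (enorm (row p (h *: delta_mx i k + q) - row r (h *: delta_mx i k +
        q)))^-1)
    (- ((q p k - q r k) * ((p == i)%:R - (r == i)%:R)) / enorm (row p q - row r q)
        ^+ 3).
Proof.
move=> pr.
have n0 : 0 < (q p 0 - q r 0) ^+ 2 + (q p 1 - q r 1) ^+ 2.
  by have := @enorm_gt0 (row p q - row r q);
      rewrite subr_eq0 enormE !mxE sqrtr_gt0; exact.
have := @is_derive_inv_dist (q p 0 - q r 0) (q p 1 - q r 1)
  (((p == i) && (0 == k))%:R - ((r == i) && (0 == k))%:R)
  (((p == i) && (1 == k))%:R - ((r == i) && (1 == k))%:R) n0.
set f := (fun h => _); set g := (fun h => _).
have -> : f = g.
  by apply/funext => h; rewrite /f /g enormE !mxE;
      congr ((Num.sqrt (_ ^+ 2 + _ ^+ 2))^-1); ring.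
move=> df; apply: (is_derive_eq df); rewrite enormE !mxE.
congr (- _ / _); move: k {f g df}; apply: ord2_ind; rewrite /= ?andbT ?andbF; ring.
Qed.

Lemma grad_potentialE m q i k : collision_free q ->
  grad_potential m q i k =
  m i * \sum_j m j * (q j k - q i k) / enorm (row j q - row i q) ^+ 3.
Proof.
move=> cf; rewrite mxE derive_along.
pose e h p r := (enorm (row p (h *: delta_mx i k + q) - row r (h *: delta_mx i k +
    q)))^-1.
pose U h := (m i0 * m i1) * e h i0 i1 + (m i0 * m i2) * e h i0 i2 + (m i1 * m i2)
    * e h i1 i2.
have -> : (fun h : R => potential m (h *: delta_mx i k + q)) = U.
  apply/funext => h; rewrite /potential sum3.
  rewrite [X in X + _ + _]big_mkcond [X in _ + X + _]big_mkcond [X in _ + _ +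
      X]big_mkcond.
  by rewrite !sum3 /= !(addr0, add0r).
have d p r (h : p != r) := @is_derive_inv_dist_row q i p r k (cf _ _ h).
have D : is_derive (0 : R) 1 U _ := is_deriveD_fun (is_deriveD_fun (is_deriveZ_fun
    (m i0 * m i1) (d i0 i1 isT)) (is_deriveZ_fun (m i0 * m i2) (d i0 i2 isT)))
  (is_deriveZ_fun (m i1 * m i2) (d i1 i2 isT)).
rewrite (@derive_val _ _ _ _ _ _ _ D) {D d}.
have sym p r : enorm (row p q - row r q) = enorm (row r q - row p q).
  by rewrite -enormN opprB.
rewrite sum3; move: i {e U}; apply: ord3_ind => /=;
    rewrite ?subrr ?(sym i1 i0) ?(sym i2 i0) ?(sym i2 i1); ring.
Qed.

End Gradient.

(* [None] is the scale [e] of the second coordinates, [Some (false, (i, k))] the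
   position and [Some (true, (i, k))] the velocity of body [i], whose second
   coordinate [k = 1] is divided by [e]. *)
Notation coord := (option (bool * ('I_3 * 'I_2))).

Definition pos (i : 'I_3) (k : 'I_2) : coord := Some (false, (i, k)).
Definition vel (i : 'I_3) (k : 'I_2) : coord := Some (true, (i, k)).

(** * The cut-off vector field: regularity, reversibility, stability *)

Section Field.
Context {R : realType}.
Implicit Types (m : 'I_3 -> R) (x y : coord -> R) (X Y : R -> coord -> R) (N d h s
    t T : R).

Definition sq_dist x (i j : 'I_3) : R := (x (pos j 0) - x (pos i 0)) ^+ 2 +
  x None ^+ 2 * (x (pos j 1) - x (pos i 1)) ^+ 2.

(* The cutoff [d] removes the singularity; Newton's equations are [d = 0]. *)
Definition newton_field m d x (c : coord) : R :=
  match c with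
  | None => 0
  | Some (false, p) => x (Some (true, p))
  | Some (true, (i, k)) => \sum_j m j * (x (pos j k) - x (pos i k)) /
      Num.sqrt (Num.max (sq_dist x i j) (d ^+ 2)) ^+ 3
  end.

(** Truncating every coordinate to [[- N, N]] makes the numerators of the field bounded; together
    with the cutoff of the distances this makes the field globally Lipschitz. *)
Definition clamp N x (c : coord) : R := Num.max (Num.min (x c) N) (- N).

Definition cut_field m N d x := newton_field m d (clamp N x).

Lemma sq_dist_ge0 x i j : 0 <= sq_dist x i j.
Proof. by apply: addr_ge0; last apply: mulr_ge0; exact: sqr_ge0. Qed.

Lemma cut_field_bounded_lipschitz m N d c : 0 <= N -> 0 < d ->
  bounded_lipschitz (fun x => cut_field m N d x c).
Proof.
move=> N0 d0.
have blc e : bounded_lipschitz (fun x => clamp N x e).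
  apply: (@bounded_lipschitz_coord _ _ (fun u => Num.max (Num.min u N) (- N)) N 1)
      => // u.
    rewrite ler_norml le_max lexx orbT /= ge_max ge_min lexx orbT /=.
    by lra.
  move=> v; rewrite mul1r; apply: (le_trans (maxr_lip _ _ _)); exact: minr_lip.
have blN (f : (coord -> R) -> R) : bounded_lipschitz f -> bounded_lipschitz (fun x
    => - f x).
  move=> /(bounded_lipschitzM (bounded_lipschitz_cst (- 1)));
      congr bounded_lipschitz.
  by apply/funext => x; rewrite mulN1r.
have blB e e' : bounded_lipschitz (fun x => clamp N x e - clamp N x e').
  by apply: bounded_lipschitzD (blN _ _).
have blX (f : (coord -> R) -> R) n : bounded_lipschitz f -> bounded_lipschitz (fun
    x => f x ^+ n).
  move=> fB; elim: n => [|n IH]; first by under eq_fun do rewrite expr0;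
      exact: bounded_lipschitz_cst.
  by under eq_fun do rewrite exprS; exact: bounded_lipschitzM.
case: c => [[[] [i k]]|]; last exact: bounded_lipschitz_cst; last exact: blc.
apply: bounded_lipschitz_sum => j; apply: bounded_lipschitzM;
    first by apply: bounded_lipschitzM; [exact: bounded_lipschitz_cst|exact: blB].
have dle x : d <= Num.sqrt (Num.max (sq_dist (clamp N x) i j) (d ^+ 2)).
  by rewrite -[leLHS](ger0_norm (ltW d0)) -sqrtr_sqr ler_wsqrtr// le_max lexx orbT.
apply: (@bounded_lipschitzV _ _ _ (d ^+ 3)); first exact: exprn_gt0.
  by move=> x; rewrite lerXn2r ?nnegrE ?sqrtr_ge0// ltW.
apply: (blX _); apply: (@bounded_lipschitz_sqrt _ _ _ d) => //.
  by move=> x; rewrite le_max lexx orbT.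
apply: bounded_lipschitz_max; apply: bounded_lipschitzD; first exact: (blX _).
by apply: bounded_lipschitzM; exact: (blX _).
Qed.

Lemma cut_fieldE m N d x : (forall c, `|x c| <= N) ->
  (forall i j, i != j -> d ^+ 2 <= sq_dist x i j) ->
  cut_field m N d x = newton_field m 0 x.
Proof.
move=> xN xd; have clampE : clamp N x = x.
  apply/funext => c; have := xN c; rewrite ler_norml => /andP[h1 h2].
  by rewrite /clamp min_l// max_l.
rewrite /cut_field clampE; apply/funext => -[[[] [i k]]|] //=.
apply: eq_bigr => j _; have [->|ij] := eqVneq i j;
    first by rewrite subrr mulr0 !mul0r.
by rewrite !max_l ?xd// expr0n /= sq_dist_ge0.
Qed.

Definition flow (F : (coord -> R) -> coord -> R) T X :=
  forall (t : R) c, 0 <= t <= T -> is_derive t 1 (X^~ c) (F (X t) c).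

Definition flip x (c : coord) : R := if c is Some (true, _) then - x c else x c.

Definition rev X t := flip (X (- t)).

Lemma flipK x : flip (flip x) = x.
Proof. by apply/funext => -[[[] p]|] //=; rewrite opprK. Qed.

Lemma newton_field_flip m d x c :
  newton_field m d (flip x) c = - flip (newton_field m d x) c.
Proof.
case: c => [[[] [i k]]|] /=; rewrite ?opprK ?oppr0//.
Qed.

(** The truncation interval is symmetric, so [clamp] is odd and commutes with the reversal of
    velocities; the cut-off field thus remains reversible. *)
Lemma cut_field_flip m N d x c : 0 <= N ->
  cut_field m N d (flip x) c = - flip (cut_field m N d x) c.
Proof.
move=> N0; rewrite /cut_field -newton_field_flip; congr newton_field.
apply/funext => -[[[] p]|] //=; rewrite /clamp /=.
set u := x _; rewrite !maxEle !minEle.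
by case: (leP (- u) N) => h1; case: (leP u N) => h2 /=; do 2?case: leP => ?; lra.
Qed.

Lemma is_derive_rev (F : (coord -> R) -> coord -> R) X t :
  (forall x c, F (flip x) c = - flip (F x) c) ->
  (forall c, is_derive (- t) 1 (X^~ c) (F (X (- t)) c)) ->
  forall c, is_derive t 1 ((rev X)^~ c) (F (rev X t) c).
Proof.
move=> Fflip XF c; rewrite /rev Fflip.
case: c => [[[] p]|] /=; try exact: is_derive_compN (XF _).
exact: is_deriveN_fun (is_derive_compN (XF _)).
Qed.

Lemma bounded_on T (f df : R -> R) :
  (forall t : R, 0 <= t <= T -> is_derive t 1 f (df t)) ->
  exists2 B, 0 <= B & forall t : R, 0 <= t <= T -> `|f t| <= B.
Proof.
move=> fd; have [T0|T0] := leP 0 T; last first.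
  by exists 0 => // t /andP[t0 tT]; move: (le_trans t0 tT); rewrite leNgt T0.
have [c _ cmax] := EVT_max T0 (is_derive_within_continuous fd).
have [e _ emin] := EVT_min T0 (is_derive_within_continuous fd).
exists (`|f c| + `|f e|) => [|t tT]; first exact: addr_ge0.
have tI : t \in `[0, T] by rewrite in_itv.
have := cmax t tI; have := emin t tI.
have := ler_norm (f c); have := lerNnormlW (lexx `|f e|).
have := normr_ge0 (f c); have := normr_ge0 (f e).
by rewrite ler_norml => *; apply/andP; split; lra.
Qed.

Lemma positive_on T (f df : R -> R) :
  (forall t : R, 0 <= t <= T -> is_derive t 1 f (df t)) ->
  (forall t : R, 0 <= t <= T -> 0 < f t) ->
  exists2 d, 0 < d & forall t : R, 0 <= t <= T -> d <= f t.
Proof.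
move=> fd f0; have [T0|T0] := leP 0 T; last first.
  by exists 1 => // t /andP[t0 tT]; move: (le_trans t0 tT); rewrite leNgt T0.
have [c cT cmin] := EVT_min T0 (is_derive_within_continuous fd).
exists (f c); first by apply: f0; rewrite in_itv in cT.
by move=> t tT; apply: cmin; rewrite in_itv.
Qed.

Lemma bounded_on_fin (I : finType) T (f df : I -> R -> R) :
  (forall i (t : R), 0 <= t <= T -> is_derive t 1 (f i) (df i t)) ->
  exists2 B, 0 <= B & forall i (t : R), 0 <= t <= T -> `|f i t| <= B.
Proof.
move=> fd; have /choice[B BE] i : exists B, 0 <= B /\ forall t : R, 0 <= t <= T ->
    `|f i t| <= B.
  by have [B B0 BE] := bounded_on (fd i); exists B.
exists (\sum_i B i); first by apply: sumr_ge0 => i _; have [] := BE i.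
move=> i t tT; apply: (le_trans ((BE i).2 t tT)).
by rewrite (bigD1 i)//= lerDl sumr_ge0// => j _; have [] := BE j.
Qed.

(** [C] is chosen before the two motions, so a tolerance on initial states can be fixed in
    advance. *)
Lemma cut_flow_stable m N d T : 0 <= N -> 0 < d -> exists2 C, 0 < C &
  forall X Y h, 0 <= h -> flow (cut_field m N d) T X -> flow (cut_field m N d) T Y
      ->
  (forall c, `|X 0 c - Y 0 c| <= h) ->
  forall (t : R) c, 0 <= t <= T -> `|X t c - Y t c| <= C * h.
Proof.
move=> N0 d0; have [L [L0 LE]] := bounded_lipschitz_uniform (fun c =>
    cut_field_bounded_lipschitz m c N0 d0).
have n0 : (0 : R) < #|{: coord}|%:R by rewrite ltr0n; apply/card_gt0P; exists None.
exists (#|{: coord}|%:R * expR (#|{: coord}|%:R * L * T)).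
  by rewrite mulr_gt0// expR_gt0.
move=> X Y h h0 XF YF XY t c tT.
apply: (@le_trans _ _ (h * (#|{: coord}|%:R * expR (#|{: coord}|%:R * L * t)))).
  apply: (@gronwall R coord (fun t c => X t c - Y t c)
    (fun t c => cut_field m N d (X t) c - cut_field m N d (Y t) c) L T h) => //.
  - exact: ltW.
  - by move=> s e sT; apply: is_deriveB_fun; [exact: XF|exact: YF].
  - by move=> s e sT H e'; exact: LE.
rewrite mulrC ler_wpM2r// ler_wpM2l ?ler_expR ?(ltW n0)// ler_wpM2l//.
  by rewrite mulr_ge0 ?ltW.
by case/andP: tT.
Qed.

Lemma is_derive_sq_dist (X dX : R -> coord -> R) i j t :
  (forall c, is_derive t 1 (X^~ c) (dX t c)) ->
  exists D, is_derive t 1 (fun t => sq_dist (X t) i j) D.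
Proof.
move=> XF; rewrite /sq_dist.
have a k := is_deriveB_fun (XF (pos j k)) (XF (pos i k)).
eexists; exact: is_deriveD_fun (is_deriveM_fun (a 0) (a 0)) (is_deriveM_fun
    (is_deriveM_fun (XF None) (XF None)) (is_deriveM_fun (a 1) (a 1))).
Qed.

Lemma newton_flow_unique m T X Y :
  flow (newton_field m 0) T X -> flow (newton_field m 0) T Y ->
  (forall (t : R) i j, 0 <= t <= T -> i != j -> 0 < sq_dist (X t) i j) ->
  (forall (t : R) i j, 0 <= t <= T -> i != j -> 0 < sq_dist (Y t) i j) ->
  X 0 = Y 0 -> forall t : R, 0 <= t <= T -> X t = Y t.
Proof.
move=> XF YF XD YD XY0.
(* Each of the two motions avoids the cut-off region for a suitable cutoff. *)
have region Z : flow (newton_field m 0) T Z ->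
    (forall (t : R) i j, 0 <= t <= T -> i != j -> 0 < sq_dist (Z t) i j) ->
    exists B, [/\ 0 < B, forall (t : R) c, 0 <= t <= T -> `|Z t c| <= B &
      forall (t : R) i j, 0 <= t <= T -> i != j -> B^-1 <= sq_dist (Z t) i j].
  move=> ZF ZD; have [B1 B10 B1E] := bounded_on_fin (fun c t => ZF t c).
  have dZ (t : R) i j : 0 <= t <= T ->
      is_derive t 1 (fun t => sq_dist (Z t) i j) ('D_1 (fun t => sq_dist (Z t) i
          j) t).
    move=> tT; have [D DE] := @is_derive_sq_dist Z (fun t => newton_field m 0 (Z
        t)) i j t
      (fun c => ZF t c tT).
    by rewrite (@derive_val _ _ _ _ _ _ _ DE).
  (* Lower bounds on the squared distances are obtained as upper bounds on their inverses; the value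
     1 on the diagonal keeps the inverted functions nonzero. *)
  have [|B2 B20 B2E] := @bounded_on_fin _ T (fun (p : 'I_3 * 'I_3) t =>
      (if p.1 == p.2 then 1 else sq_dist (Z t) p.1 p.2)^-1)
    (fun p t => if p.1 == p.2 then 0 else
      - 'D_1 (fun t => sq_dist (Z t) p.1 p.2) t / sq_dist (Z t) p.1 p.2 ^+ 2).
    move=> [i j] t tT /=; case: eqVneq => ij; first exact: is_derive_cst_fun.
    by apply: is_deriveV_fun (dZ t i j tT); rewrite gt_eqF// ZD.
  exists (1 + B1 + B2); split.
  - by rewrite -addrA ltr_pwDl// addr_ge0.
  - by move=> t c tT; apply: (le_trans (B1E c t tT)); lra.
  - move=> t i j tT ij; have := B2E (i, j) t tT; rewrite /= (negbTE ij).
    have D0 := ZD t i j tT ij; rewrite gtr0_norm ?invr_gt0// => h.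
    rewrite -[leRHS]invrK lef_pV2 ?posrE ?invr_gt0//; last by lra.
    by apply: (le_trans h); lra.
have [B [B0 BN BD]] := region X XF XD; have [C [C0 CN CD]] := region Y YF YD.
pose N := B + C; have N0 : 0 < N by rewrite addr_gt0.
(* As [d <= 1], one has [d ^+ 2 <= d <= E^-1] for every [E <= N], which places both motions outside
   the cutoff. *)
pose d := (1 + N)^-1; have d0 : 0 < d by rewrite invr_gt0 addr_gt0.
have dle E : 0 < E -> E <= N -> d ^+ 2 <= E^-1.
  move=> E0 EN; apply: (@le_trans _ _ d).
    by rewrite expr2 ger_pMr// /d invf_le1 ?addr_gt0// lerDl ltW.
  by rewrite /d lef_pV2 ?posrE ?addr_gt0//; lra.
have cut Z E : 0 < E -> E <= N -> flow (newton_field m 0) T Z ->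
    (forall (t : R) c, 0 <= t <= T -> `|Z t c| <= E) ->
    (forall (t : R) i j, 0 <= t <= T -> i != j -> E^-1 <= sq_dist (Z t) i j) ->
    flow (cut_field m N d) T Z.
  move=> E0 EN ZF ZN ZD t c tT; rewrite cut_fieldE; first exact: ZF.
    by move=> e; apply: le_trans EN; exact: ZN.
  by move=> i j ij; apply: (le_trans (dle E E0 EN)); exact: ZD.
have BN' : B <= N by rewrite /N lerDl ltW.
have CN' : C <= N by rewrite /N lerDr ltW.
have [c c0 cE] := cut_flow_stable m T (ltW N0) d0.
move=> t tT; apply/funext => e; apply/eqP; rewrite -subr_eq0 -normr_le0.
(* Uniqueness is stability with initial deviation 0. *)
have -> : 0 = c * 0 by rewrite mulr0.
apply: cE (lexx 0) (cut X B B0 BN' XF BN BD) (cut Y C C0 CN' YF CN CD) _ t e tT.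
by move=> e'; rewrite XY0 subrr normr0.
Qed.

End Field.

(** * Solutions of Newton's equations versus motions of the first-order system *)

Section Solutions.
Context {R : realType}.
Implicit Types (m : 'I_3 -> R) (x : coord -> R) (q : R -> config R) (e s t T : R)
  (X : R -> coord -> R) (J : set R).

Definition scale e (k : 'I_2) : R := if k == 0 then 1 else e.

Definition to_config e x : config R := \matrix_(i, k) (scale e k * x (pos i k)).

Definition to_velocity e x : config R := \matrix_(i, k) (scale e k * x (vel i k)).

Definition of_state e (u v : config R) (c : coord) : R :=
  match c with
  | None => e
  | Some (b, (i, k)) => (if b then v i k else u i k) / scale e k
  end.

Lemma scale_neq0 e k : e != 0 -> scale e k != 0.
Proof. by rewrite /scale; case: ifP; rewrite ?oner_eq0. Qed.

Lemma to_of_config e u v : e != 0 -> to_config e (of_state e u v) = u.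
Proof.
by move=> e0; apply/matrixP => i k; rewrite mxE /= mulrC divfK// scale_neq0.
Qed.

Lemma enorm_to_config e x i j : x None = e ->
  enorm (row j (to_config e x) - row i (to_config e x)) = Num.sqrt (sq_dist x i j).
Proof.
move=> xe; rewrite enormE !mxE /sq_dist xe /scale /=; congr Num.sqrt; ring.
Qed.

Lemma sq_dist_gt0P e x : x None = e ->
  (forall i j, i != j -> 0 < sq_dist x i j) <-> collision_free (to_config e x).
Proof.
move=> xe; split=> [h i j ij|h i j ij].
  rewrite -subr_eq0; apply/eqP => E.
  have := h j i; rewrite eq_sym ij => /(_ isT).
  rewrite -sqrtr_gt0 -(enorm_to_config _ _ xe) E enormE !mxE expr0n addr0 sqrtr0.
  by rewrite ltxx.
rewrite -sqrtr_gt0 -(enorm_to_config _ _ xe); apply: enorm_gt0.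
by rewrite subr_eq0 h// eq_sym.
Qed.

Lemma is_derive_mxP (M : R -> config R) (dM : config R) t :
  is_derive t 1 M dM <-> forall i k, is_derive t 1 (fun s => M s i k) (dM i k).
Proof.
split=> [[Mt <-] i k|h].
  by rewrite derive_mx// mxE; apply: DeriveDef => //;
      exact: (derivable_mxP M t 1).1.
have Mt : derivable M t 1 by apply/derivable_mxP => i k; case: (h i k).
apply: DeriveDef => //; rewrite derive_mx//; apply/matrixP => i k.
by rewrite mxE; case: (h i k).
Qed.

Lemma newton_accelerationE m e x i k : x None = e -> e != 0 ->
  collision_free (to_config e x) -> m i != 0 ->
  m i * (scale e k * newton_field m 0 x (vel i k)) =
  grad_potential m (to_config e x) i k.
Proof.
move=> xe e0 cf mi0; rewrite grad_potentialE//=; congr (_ * _).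
rewrite big_distrr; apply: eq_bigr => j _ /=.
rewrite enorm_to_config// max_l ?expr0n ?sq_dist_ge0// !mxE.
by rewrite mulrA mulrCA -mulrBr.
Qed.

Lemma near_eq_derive1 (f g : R -> config R) t : {near t, f =1 g} ->
  {near t, derive1 f =1 derive1 g}.
Proof.
move=> fg; have := near_join fg; apply: filterS => s fgs.
by rewrite !derive1E; exact: near_eq_derive.
Qed.

Lemma flow_solution m e J X : (forall i, 0 < m i) -> e != 0 ->
  is_interval J -> open J ->
  (forall t, J t -> forall c, is_derive t 1 (X^~ c) (newton_field m 0 (X t) c)) ->
  (forall t, J t -> X t None = e) ->
  (forall t, J t -> forall i j, i != j -> 0 < sq_dist (X t) i j) ->
  solution m J (fun t => to_config e (X t)) /\
  forall t, J t -> derive1 (fun t => to_config e (X t)) t = to_velocity e (X t).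
Proof.
move=> m_gt0 e0 iJ oJ XF Xe XD; set q := fun t => to_config e (X t).
have dq t : J t -> is_derive t 1 q (to_velocity e (X t)).
  move=> Jt; apply/is_derive_mxP => i k; rewrite mxE.
  have -> : (fun s => q s i k) = (fun s => scale e k * X s (pos i k)).
    by apply/funext => s; rewrite mxE.
  exact: is_deriveZ_fun (XF t Jt (pos i k)).
have d1q t : J t -> derive1 q t = to_velocity e (X t).
  by move=> Jt; rewrite derive1E (@derive_val _ _ _ _ _ _ _ (dq t Jt)).
have ddq t : J t -> is_derive t 1 (derive1 q)
    (\matrix_(i, k) (scale e k * newton_field m 0 (X t) (vel i k))).
  move=> Jt; apply: (@near_eq_is_derive _ _ _ (fun t => to_velocity e (X t))).
    have := open_nbhs_nbhs (conj oJ Jt); apply: filterS => s Js.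
    by rewrite d1q.
  apply/is_derive_mxP => i k; rewrite mxE.
  have -> : (fun s => to_velocity e (X s) i k) = (fun s => scale e k * X s (vel i
      k)).
    by apply/funext => s; rewrite mxE.
  exact: is_deriveZ_fun (XF t Jt (vel i k)).
split=> //; split=> // t Jt.
have cf : collision_free (q t) by apply/(sq_dist_gt0P (Xe t Jt)); exact: XD.
split=> //.
- by case: (dq t Jt).
- by case: (ddq t Jt).
move=> i; apply/rowP => k.
rewrite [in LHS]derive1E (@derive_val _ _ _ _ _ _ _ (ddq t Jt)) !mxE.
have := @newton_accelerationE m e (X t) i k (Xe t Jt) e0 cf.
by rewrite gt_eqF// => /(_ isT) ->; rewrite mxE.
Qed.

Lemma solution_flow m e J q : (forall i, 0 < m i) -> e != 0 ->
  solution m J q -> let X t := of_state e (q t) (derive1 q t) in forall t, J t ->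
  (forall c, is_derive t 1 (X^~ c) (newton_field m 0 (X t) c)) /\
  (forall i j, i != j -> 0 < sq_dist (X t) i j).
Proof.
move=> m_gt0 e0 [iJ oJ sol] X t Jt; have [cf dq ddq newton] := sol t Jt.
have qE : to_config e (X t) = q t by rewrite /X to_of_config.
have cf' : collision_free (to_config e (X t)) by rewrite qE.
split; last by apply/(@sq_dist_gt0P e).
have dZ (f : R -> R) (a : R) k : is_derive t 1 f a ->
    is_derive t 1 (fun s => f s / scale e k) (a / scale e k).
  move=> fa; apply: (is_derive_eq (is_deriveM_fun fa (is_derive_cst_fun (scale e
      k)^-1 t))).
  by rewrite mulr0 addr0.
have dQ : is_derive t 1 q (derive1 q t) by rewrite derive1E; exact: (derivableP dq).
have dV : is_derive t 1 (derive1 q) (derive1 (derive1 q) t).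
  by rewrite [derive1 (derive1 q) t]derive1E; exact: (derivableP ddq).
move=> [[[] [i k]]|] /=; last exact: is_derive_cst_fun.
- have -> : \sum_j m j * (q t j k / scale e k - q t i k / scale e k) /
      Num.sqrt (Num.max (sq_dist (X t) i j) (0 ^+ 2)) ^+ 3 =
      derive1 (derive1 q) t i k / scale e k.
    have mi0 : m i != 0 by rewrite gt_eqF.
    have sk := scale_neq0 k e0.
    apply: (mulfI mi0); apply: (mulfI sk).
    have /rowP/(_ k) := newton i; rewrite !mxE => E.
    have := @newton_accelerationE m e (X t) i k erefl e0 cf' mi0.
    rewrite qE mxE -E /= => F.
    by rewrite mulrCA F; field.
  by apply: dZ; exact: (is_derive_mxP _ _ _).1 dV i k.
- by apply: dZ; exact: (is_derive_mxP _ _ _).1 dQ i k.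
Qed.

(** Being a solution is local on open sets, and two intervals through 0 have an interval as union.
    Applied to a maximal solution, this forces [J'] into its domain. *)
Lemma solution_glue m J J' q q' : solution m J q -> solution m J' q' ->
  J 0 -> J' 0 -> (forall t, J t -> J' t -> q t = q' t) ->
  solution m (J `|` J') (fun t => if `[< J t >] then q t else q' t).
Proof.
move=> [iJ oJ sol] [iJ' oJ' sol'] J0 J'0 agree; set p := fun t => _.
have local f t : {near t, f =1 p} ->
    [/\ collision_free (f t), derivable f t 1, derivable (derive1 f) t 1 &
            forall i : 'I_3,
              m i *: row i (derive1 (derive1 f) t) = row i (grad_potential m (f
              t))] ->
    [/\ collision_free (p t), derivable p t 1, derivable (derive1 p) t 1 &
            forall i : 'I_3,
              m i *: row i (derive1 (derive1 p) t) = row i (grad_potential m (p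
              t))].
  move=> fp [h1 h2 h3 h4]; rewrite -(nbhs_singleton fp).
  have fp1 := near_eq_derive1 fp; have fp2 := near_eq_derive1 fp1.
  split; [exact: h1|exact: near_eq_derivable fp h2|exact: near_eq_derivable fp1
      h3|].
  by move=> i; rewrite -(nbhs_singleton fp2).
split; last 1 first.
- move=> t; have [Jt _|nJt [//|J't]] := pselect (J t).
    apply: local (sol t Jt); have := open_nbhs_nbhs (conj oJ Jt).
    by apply: filterS => s Js; rewrite /p asboolT.
  apply: local (sol' t J't); have := open_nbhs_nbhs (conj oJ' J't).
  apply: filterS => s J's; rewrite /p; case: asboolP => // Js.
  by rewrite agree.
- move=> a b Ja Jb c /andP[ac cb].
  have [c0|c0] := leP c 0.
    by case: Ja => Ja; [left; apply: (iJ a 0)|right; apply: (iJ' a 0)] => //;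
        rewrite ac.
  by case: Jb => Jb; [left; apply: (iJ 0 b)|right; apply: (iJ' 0 b)] => //;
      rewrite (ltW c0).
- exact: openU.
Qed.

End Solutions.

(** * Motions close to an Euler configuration *)

Section Stability.
Context {R : realType}.
Implicit Types (m a b : 'I_3 -> R) (x y : coord -> R) (d e h s t w K N T : R)
  (X : R -> coord -> R).

(** The zero is the infimum of the times in [[0, T]] with [f <= 0]. A negative value there would
    persist slightly earlier, and a positive one slightly later. *)
Lemma first_zero (f : R -> R) T : continuous f -> 0 < T -> 0 < f 0 -> f T < 0 ->
  exists t, [/\ 0 < t < T, f t = 0 & forall s, 0 <= s < t -> f s != 0].
Proof.
move=> cf T0 f0 fT.
pose S := [set t | 0 <= t <= T /\ f t <= 0].
have ST : S T by split; rewrite ?lexx ?ltW.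
have lbS : lbound S 0 by move=> t [/andP[]].
have infS : has_inf S by split; [exists T|exists 0].
pose z := inf S.
have z0 : 0 <= z by apply: lb_le_inf => //; exists T.
have zS t : S t -> z <= t by move=> St; apply: ge_inf => //; exists 0.
have fz0 : 0 <= f z.
  rewrite leNgt; apply/negP => fz.
  have zn0 : z != 0 by apply: contraTneq fz => ->; rewrite -leNgt ltW.
  have zpos : 0 < z by rewrite lt_neqAle eq_sym zn0.
  have /cvgrPdist_lt/(_ (- f z)) := cf z; rewrite oppr_gt0 => /(_ fz)[r /= r0 rf].
  pose u := Num.max (z - r / 2) 0.
  have uz : u < z by rewrite gt_max zpos andbT; lra.
  have u0 : 0 <= u by rewrite le_max lexx orbT.
  have uE : z - r / 2 <= u by rewrite le_max lexx.
  have : `|z - u| < r by rewrite ger0_norm; lra.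
  move=> /rf; rewrite ltr_norml => /andP[h _].
  have : S u.
    split; last by lra.
    by rewrite u0 (le_trans (ltW uz))// zS.
  by move=> /zS; rewrite leNgt uz.
have fz : f z = 0.
  apply/eqP; rewrite eq_le fz0 andbT leNgt; apply/negP => fz.
  have /cvgrPdist_lt/(_ _ fz)[r /= r0 rf] := cf z.
  have [t St tz] := inf_adherent r0 infS.
  have zt := zS _ St.
  have : `|z - t| < r by rewrite distrC ger0_norm -/z ?subr_ge0//; move: tz;
      rewrite -/z; lra.
  move=> /rf; rewrite ltr_norml => /andP[_ h].
  by have [_] := St; lra.
have zT : z <= T by exact: zS.
exists z; split=> //.
  rewrite !lt_neqAle z0 zT !andbT; apply/andP; split.
    by apply/eqP => E; move: f0; rewrite [in f 0]E fz ltxx.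
  by apply/eqP => E; move: fT; rewrite -E fz ltxx.
move=> s /andP[s0 sz]; apply/eqP => fs.
have : S s by split; rewrite ?fs// s0 (le_trans (ltW sz)).
by move=> /zS; rewrite leNgt sz.
Qed.

(* Twice the oriented area of the triangle, divided by the scale of the second
   coordinate. *)
Definition area x : R :=
  (x (pos i1 0) - x (pos i0 0)) * (x (pos i2 1) - x (pos i0 1)) -
  (x (pos i2 0) - x (pos i0 0)) * (x (pos i1 1) - x (pos i0 1)).

(** Keeps body 2 between bodies 1 and 3 along the first axis; this excludes collisions and also
    determines the type of any syzygy. *)
Definition ordered d x : Prop :=
  d <= x (pos i1 0) - x (pos i0 0) /\ d <= x (pos i2 0) - x (pos i1 0).

Lemma ordered_sq_dist d x : 0 <= d -> ordered d x ->
  forall i j, i != j -> d ^+ 2 <= sq_dist x i j.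
Proof.
move=> d0 [h1 h2].
have sq u v : d <= `|u| -> d ^+ 2 <= u ^+ 2 + x None ^+ 2 * v ^+ 2.
  move=> du; rewrite -[d ^+ 2]addr0; apply: lerD (mulr_ge0 (sqr_ge0 _) (sqr_ge0 _)).
  by rewrite -(real_normK (num_real u)) lerXn2r ?nnegrE.
have := ler_norm (x (pos i1 0) - x (pos i0 0)).
have := ler_norm (x (pos i2 0) - x (pos i1 0)).
have := ler_norm (x (pos i2 0) - x (pos i0 0)).
move=> n1 n2 n3.
move=> i j; elim/ord3_ind: i; elim/ord3_ind: j => // _;
  apply: sq; first [lra | rewrite distrC; lra].
Qed.

Lemma mul_close (p q p' q' h N : R) : `|p - p'| <= h -> `|q - q'| <= h ->
  `|q| <= N -> `|p'| <= N -> `|p * q - p' * q'| <= 2 * h * N.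
Proof.
move=> ph qh qN pN.
have -> : p * q - p' * q' = (p - p') * q + p' * (q - q') by ring.
apply: (le_trans (ler_normD _ _)); rewrite !normrM.
have -> : 2 * h * N = h * N + N * h by ring.
by apply: lerD; apply: ler_pM.
Qed.

Lemma area_close x y h N : (forall c, `|x c - y c| <= h) ->
  (forall c, `|x c| <= N) -> (forall c, `|y c| <= N) ->
  `|area x - area y| <= 16 * h * N.
Proof.
move=> xy xN yN.
have dxy c c' : `|(x c - x c') - (y c - y c')| <= 2 * h.
  have -> : (x c - x c') - (y c - y c') = (x c - y c) - (x c' - y c') by ring.
  by apply: (le_trans (ler_normB _ _)); have := xy c; have := xy c'; lra.
have dx (z : coord -> R) c c' : (forall c, `|z c| <= N) -> `|z c - z c'| <= 2 * N.
  by move=> zN; apply: (le_trans (ler_normB _ _)); have := zN c; have := zN c'; lra.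
pose D z i k : R := z (pos i k) - z (pos i0 k).
have -> : area x - area y = (D x i1 0 * D x i2 1 - D y i1 0 * D y i2 1) -
    (D x i2 0 * D x i1 1 - D y i2 0 * D y i1 1) by rewrite /area /D; ring.
have c i j : `|D x i 0 * D x j 1 - D y i 0 * D y j 1| <= 2 * (2 * h) * (2 * N).
  by apply: mul_close; [exact: dxy|exact: dxy|exact: dx|exact: dx].
by apply: (le_trans (ler_normB _ _)); apply: (le_trans (lerD (c _ _) (c _ _))); lra.
Qed.

(** A state of the limit system, with scale 0: [b] is recorded as a rescaled displacement although
    the configuration it describes is flat. *)
Definition euler_state a b (la dla mu dmu : R) (c : coord) : R :=
  match c with
  | None => 0
  | Some (f, (i, k)) => if k == 0 then (if f then dla else la) * a i
                        else (if f then dmu else mu) * b i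
  end.

(** At scale 0 the distances are [la * |a j - a i|], so the transverse displacement does not act on
    the motion along the line, and the two eigenvector equations reduce the system to [la] and
    [mu]. *)
Lemma euler_flow m a b w K T (la dla mu dmu : R -> R) :
  euler_configuration m a b w K ->
  (forall t, 0 <= t <= T -> [/\ 0 < la t,
      is_derive t 1 la (dla t), is_derive t 1 dla (- w / la t ^+ 2),
      is_derive t 1 mu (dmu t) & is_derive t 1 dmu (- K * mu t / la t ^+ 3)]) ->
  flow (newton_field m 0) T (fun t => euler_state a b (la t) (dla t) (mu t) (dmu
      t)).
Proof.
move=> [_ _ _ [aE bE] _] motion t c tT; have [l0 d1 d2 d3 d4] := motion t tT.
have dZ (f : R -> R) u v : is_derive t 1 f u -> is_derive t 1 (fun s => f s * v)
    (u * v).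
  by move=> fu; apply: (is_derive_eq (is_deriveM_fun fu (is_derive_cst_fun v t)));
      rewrite mulr0 addr0.
have distE i j : Num.sqrt (Num.max (sq_dist (euler_state a b (la t) (dla t) (mu t)
    (dmu t)) i j)
    (0 ^+ 2)) = la t * `|a j - a i|.
  rewrite max_l ?expr0n ?sq_dist_ge0// /sq_dist /= expr0n /= mul0r addr0.
  by rewrite -mulrBr sqrtr_sqr normrM gtr0_norm.
have ln0 : la t != 0 by rewrite gt_eqF.
case: c => [[[] [i k]]|] /=; last exact: is_derive_cst_fun.
- case: eqVneq => k0.
    apply: (is_derive_eq (dZ _ _ (a i) d2)).
    have -> : - w / la t ^+ 2 * a i = (la t ^+ 2)^-1 * (- w * a i) by ring.
    rewrite -aE big_distrr; apply: eq_bigr => j _ /=;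
        rewrite distE exprMn [(la t ^+ 3 * _)^-1]invfM -!mulrBr.
    by move: (`|a j - a i| ^+ 3)^-1 => z; field.
  apply: (is_derive_eq (dZ _ _ (b i) d4)).
  have -> : - K * mu t / la t ^+ 3 * b i = mu t / la t ^+ 3 * (- K * b i) by ring.
  rewrite -bE big_distrr; apply: eq_bigr => j _ /=;
      rewrite distE exprMn [(la t ^+ 3 * _)^-1]invfM -!mulrBr.
  by move: (`|a j - a i| ^+ 3)^-1 => z; field.
- by case: eqVneq => k0; exact: dZ.
Qed.

End Stability.

(** * Stuttering near an Euler configuration at rest *)

Section Stutter.
Context {R : realType}.
Implicit Types (m a b : 'I_3 -> R) (x y : coord -> R) (d e h s t w K N T : R)
  (X : R -> coord -> R) (J : set R).

(** Formulated for the cut-off field, whose motions exist up to time [T]; the bounds obtained say in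
    turn that this field is Newton's along [X]. *)
Lemma euler_tube m a b w K : euler_configuration m a b w K ->
  exists N d h T, [/\ 0 < N, 0 < d, 0 < h, 0 < T &
  forall X, flow (cut_field m N d) T X ->
    (forall c, `|X 0 c - euler_state a b 1 0 1 0 c| <= h) ->
    [/\ forall t, 0 <= t <= T -> (forall c, `|X t c| <= N) /\ ordered d (X t),
        0 < area (X 0) & area (X T) < 0]].
Proof.
move=> euler; have [/andP[w0 wK] /andP[a01 a12] _ _ A0] := euler.
have [T [la [dla [mu [dmu [T0 [la0 dla0 mu0 dmu0] muT motion]]]]]] :=
  reference_motion w0 wK.
pose Y t := euler_state a b (la t) (dla t) (mu t) (dmu t).
have YF : flow (newton_field m 0) T Y by exact: euler_flow euler motion.
have [B B0 BY] := bounded_on_fin (fun c t => YF t c).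
have [l l0 lE] := positive_on (fun t tT => let: And5 _ h _ _ _ := motion t tT in h)
  (fun t tT => let: And5 h _ _ _ _ := motion t tT in h).
pose g := Num.min (a i1 - a i0) (a i2 - a i1).
have g0 : 0 < g by rewrite lt_min !subr_gt0 a01.
pose G := l * g; have G0 : 0 < G by rewrite mulr_gt0.
have Ygap t : 0 <= t <= T -> ordered G (Y t).
  move=> tT; rewrite /ordered /Y /= -!mulrBr; split;
    by apply: ler_pM; rewrite ?(ltW l0) ?(ltW g0) ?lE// ge_min lexx ?orbT.
pose A := (a i1 - a i0) * (b i2 - b i0) - (a i2 - a i0) * (b i1 - b i0).
have areaY t : area (Y t) = la t * mu t * A by rewrite /area /Y /A /=; ring.
have TT : 0 <= T <= T by rewrite lexx ltW.
have T00 : 0 <= (0 : R) <= T by rewrite lexx ltW.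
have laT : 0 < la T by have [] := motion T TT.
have AT : 0 < - area (Y T).
  rewrite areaY -mulNr; apply: mulr_gt0 A0.
  by rewrite -mulrN mulr_gt0// oppr_gt0.
pose N := B + 1; have N0 : 0 < N by rewrite ltr_wpDl.
(* Half the smaller of the reference areas at the two ends, in absolute value: an error of at most
   [z] preserves both signs. *)
pose z := Num.min A (- area (Y T)) / 2.
have z0 : 0 < z by rewrite divr_gt0// lt_min AT andbT.
(* Admissible deviation from the reference: 1 keeps the coordinates below [N = B + 1], [G / 4] for
   each body keeps the gaps above [G / 2], and the last term comes from [area_close]. *)
pose k := Num.min 1 (Num.min (G / 4) (z / (16 * N))).
have k0 : 0 < k.
  have h1 : 0 < G / 4 by rewrite divr_gt0.
  have h2 : 0 < z / (16 * N) by rewrite divr_gt0// mulr_gt0.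
  by rewrite !lt_min ltr01 h1.
have k1 : k <= 1 by rewrite ge_min lexx.
have kG : k <= G / 4 by rewrite !ge_min lexx !orbT.
have kz : 16 * k * N <= z.
  have : k <= z / (16 * N) by rewrite !ge_min lexx !orbT.
  by rewrite ler_pdivlMr ?mulr_gt0// mulrCA mulrA.
pose d := G / 2; have d0 : 0 < d by rewrite divr_gt0.
have YN t c : 0 <= t <= T -> `|Y t c| <= N.
  by move=> tT; apply: (le_trans (BY c t tT)); rewrite lerDl.
have Ycut : flow (cut_field m N d) T Y.
  move=> t c tT; rewrite cut_fieldE; [exact: YF|by move=> e; exact: YN|].
  apply: ordered_sq_dist; first exact: ltW.
  by have [h1 h2] := Ygap t tT; split; rewrite /d; lra.
have [C C0 CE] := cut_flow_stable m T (ltW N0) d0.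
have kC : 0 < k / C by rewrite divr_gt0.
exists N, d, (k / C), T; split=> // X XF X0.
have Y0 : Y 0 = euler_state a b 1 0 1 0 by rewrite /Y la0 dla0 mu0 dmu0.
have XY t c : 0 <= t <= T -> `|X t c - Y t c| <= k.
  move=> tT; have := CE X Y (k / C) (ltW kC) XF Ycut _ t c tT.
  rewrite [C * _]mulrC divfK ?gt_eqF//; apply=> e; rewrite Y0; exact: X0.
have XN t c : 0 <= t <= T -> `|X t c| <= N.
  move=> tT; rewrite -[X t c](subrK (Y t c)) (le_trans (ler_normD _ _))//.
  by have := XY t c tT; have := BY c t tT; rewrite /N; lra.
have Xarea t : 0 <= t <= T -> `|area (X t) - area (Y t)| <= z.
  move=> tT; apply: le_trans kz; apply: area_close => c;
      [exact: XY|exact: XN|exact: YN].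
split.
- move=> t tT; split; first by move=> c; exact: XN.
  have [h1 h2] := Ygap t tT.
  have cl i := XY t (pos i 0) tT.
  have := cl i0; have := cl i1; have := cl i2; rewrite !ler_norml.
  by move=> /andP[u1 u2] /andP[u3 u4] /andP[u5 u6]; split; rewrite /d; lra.
- have := Xarea 0 T00; rewrite ler_norml areaY la0 mu0 !mul1r => /andP[h _].
  have : z <= A / 2 by rewrite ler_pM2r ?invr_gt0// ge_min lexx.
  by move: A0 h; rewrite -/A; lra.
- have := Xarea T TT; rewrite ler_norml => /andP[_ h].
  have : z <= - area (Y T) / 2 by rewrite ler_pM2r ?invr_gt0// ge_min lexx orbT.
  by lra.
Qed.

Lemma collinear_area e x : e != 0 -> collinear (to_config e x) -> area x = 0.
Proof.
move=> e0 [p [v pv]].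
have /choice[s sE] := pv.
have E i k : scale e k * x (pos i k) = p 0 k + s i * v 0 k.
  by have /rowP/(_ k) := sE i; rewrite !mxE.
have E0 i : x (pos i 0) = p 0 0 + s i * v 0 0 by rewrite -E /scale /= mul1r.
have E1 i : x (pos i 1) = (p 0 1 + s i * v 0 1) / e.
  by rewrite -E /scale /= mulrC mulKf.
by rewrite /area !E0 !E1; field.
Qed.

Lemma area_syzygy d e x : e != 0 -> 0 < d -> x None = e -> ordered d x ->
  area x = 0 -> syzygy_of_type (to_config e x) i1.
Proof.
move=> e0 d0 xe ord area0; have [h1 h2] := ord.
have cf : collision_free (to_config e x).
  apply/(sq_dist_gt0P xe) => i j ij; apply: (@lt_le_trans _ _ (d ^+ 2)).
    exact: exprn_gt0.
  exact: ordered_sq_dist (ltW d0) ord _ _ ij.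
set q := to_config e x in cf *.
pose D := x (pos i2 0) - x (pos i0 0).
have D0 : 0 < D by rewrite /D; lra.
pose s := (x (pos i1 0) - x (pos i0 0)) / D.
have sD : s * D = x (pos i1 0) - x (pos i0 0) by rewrite divfK// gt_eqF.
(* Zero area means that the barycentric parameter [s] of the first coordinates also serves for the
   second ones. *)
have sy : s * (x (pos i2 1) - x (pos i0 1)) = x (pos i1 1) - x (pos i0 1).
  apply: (mulfI (x := D)); first by rewrite gt_eqF.
  by rewrite mulrA [D * s]mulrC sD; apply/eqP; rewrite -subr_eq0 -/(area x);
      apply/eqP.
have mid : row i1 q = (1 - s) *: row i0 q + s *: row i2 q.
  apply/rowP; apply: ord2_ind; rewrite !mxE /scale /=.
    by move: sD; rewrite /D => sD; lra.
  have -> : x (pos i1 1) = x (pos i0 1) + s * (x (pos i2 1) - x (pos i0 1)).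
    by rewrite sy; ring.
  by ring.
split=> //.
  split; last by move=> /(_ i0 i1) E; have := cf i0 i1 isT; rewrite E eqxx.
  exists (row i0 q), (row i2 q - row i0 q); apply: ord3_ind.
  - by exists 0; rewrite scale0r addr0.
  - by exists s; rewrite mid scalerBl scale1r scalerBr addrA addrAC.
  - by exists 1; rewrite scale1r addrC subrK.
exists i0, i2; split=> //; exists s => //.
rewrite divr_gt0//=; last by lra.
by rewrite ltr_pdivrMr// mul1r /D; lra.
Qed.

(* A trajectory issued from a state close to the Euler configuration at rest is
   compared with the reference motion on [0, T] and, after time reversal, on
   [-T, 0]. *)
Lemma stutter_near_euler m a b w K : (forall i, 0 < m i) ->
  euler_configuration m a b w K ->
  exists2 h, 0 < h & forall e (u v : config R) J (q : R -> config R),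
    0 < e -> (forall c, `|of_state e u v c - euler_state a b 1 0 1 0 c| <= h) ->
    maximal_solution m J q -> J 0 -> q 0 = u -> derive1 q 0 = v -> stuttering J q.
Proof.
move=> m_gt0 euler.
have [N [d [h [T [N0 d0 h0 T0 tube]]]]] := euler_tube euler.
exists h => // e u v J q e0 uvh [sol max] J0 qu dqv.
have en0 : e != 0 by rewrite gt_eqF.
have [X [X0 XE]] := picard_bounded_lipschitz (of_state e u v) (fun c =>
    cut_field_bounded_lipschitz m c (ltW N0) d0).
have XF : flow (cut_field m N d) T X by move=> t c _; exact: XE.
have revE t c : is_derive t 1 ((rev X)^~ c) (cut_field m N d (rev X t) c).
  exact: (is_derive_rev (fun x c' => cut_field_flip m d x c' (ltW N0)) (XE (- t))).
have revF : flow (cut_field m N d) T (rev X) by move=> t c _; exact: revE.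
have [|Xtube areaX0 areaXT] := tube X XF; first by move=> c; rewrite X0.
(* The reference starts with zero velocity, so changing the sign of the velocities does not alter
   the distance to it. *)
have [|revtube _ areaRT] := tube (rev X) revF.
  move=> c; rewrite /rev oppr0 X0; move: (uvh c).
  case: c => [[[] [i k]]|] //=.
  by rewrite !mul0r if_same !subr0 normrN.
have X_None t : X t None = e.
  have -> : X t None = X 0 None.
    by apply: (@is_derive_0_is_cst R (X^~ None)) => s; exact: XE s None.
  by rewrite X0.
have abs_tube t : `|t| <= T -> (forall c, `|X t c| <= N) /\ ordered d (X t).
  have [t0|t0] := leP 0 t; first by rewrite ger0_norm// => tT; apply: Xtube;
      rewrite t0.
  rewrite ltr0_norm// => tT; have [|h1 [h2 h3]] := revtube (- t).
    by rewrite tT oppr_ge0 ltW.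
  split; last by move: h2 h3; rewrite /rev opprK.
  by move=> c; have := h1 c; rewrite /rev opprK; case: c => [[[] p]|] //=;
      rewrite normrN.
have dist_ge t i j : `|t| <= T -> i != j -> d ^+ 2 <= sq_dist (X t) i j.
  by move=> /abs_tube[_ /(ordered_sq_dist (ltW d0))]; apply.
have dist_gt t i j : `|t| <= T -> i != j -> 0 < sq_dist (X t) i j.
  by move=> tT ij; apply: lt_le_trans (dist_ge t i j tT ij); exact: exprn_gt0.
have XN t c : `|t| <= T -> is_derive t 1 (X^~ c) (newton_field m 0 (X t) c).
  move=> tT; have := XE t c; rewrite cut_fieldE//;
      first by have [] := abs_tube t tT.
  by move=> i j; exact: dist_ge.
pose I : set R := [set t | `|t| < T].
have IT t : I t -> `|t| <= T by exact: ltW.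
have I0 : I 0 by rewrite /I /= normr0.
have II : is_interval I.
  move=> x y Ix Iy z /andP[xz zy]; move: Ix Iy; rewrite /I /= !ltr_norml.
  by move=> /andP[? ?] /andP[? ?]; apply/andP; split; lra.
have oI : open I.
  rewrite (_ : I = ball (0 : R) T); first exact: ball_open.
  by apply/seteqP; split=> t; rewrite /I /ball /= sub0r normrN.
have [solI dI] := flow_solution m_gt0 en0 II oI (fun t It c => XN t c (IT t It))
  (fun t _ => X_None t) (fun t It i j ij => dist_gt t i j (IT t It) ij).
pose Z t := of_state e (q t) (derive1 q t).
have ZF := solution_flow m_gt0 en0 sol.
have [iJ oJ _] := sol.
have Z0 : Z 0 = X 0 by rewrite X0 /Z qu dqv.
have ZX t : J t -> I t -> Z t = X t.
  move=> Jt It.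
  have [t0|t0] := leP 0 t.
    have Js s : 0 <= s <= t -> J s by move=> st; apply: (iJ 0 t).
    have Ts s : 0 <= s <= t -> `|s| <= T.
      move=> /andP[s0 st]; rewrite ger0_norm// (le_trans st)//.
      by have := IT t It; rewrite ger0_norm.
    apply: (@newton_flow_unique R m t Z X) => //.
    - by move=> s c /Js Js'; have [+ _] := ZF s Js'; apply.
    - by move=> s c /Ts; exact: XN.
    - by move=> s i j /Js Js'; have [_ +] := ZF s Js'; apply.
    - by move=> s i j /Ts; exact: dist_gt.
    - by rewrite t0 lexx.
  have Js s : 0 <= s <= - t -> J (- s).
    by move=> /andP[s0 st]; apply: (iJ t 0) => //; apply/andP; split; lra.
  have Ts s : 0 <= s <= - t -> `|- s| <= T.
    move=> /andP[s0 st]; rewrite normrN ger0_norm// (le_trans st)//.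
    by have := IT t It; rewrite ltr0_norm.
  (* Uniqueness is available for nonnegative times; negative ones are reached by reversing both
     motions. *)
  suff : rev Z (- t) = rev X (- t).
    by rewrite /rev opprK => E; rewrite -(flipK (Z t)) E flipK.
  apply: (@newton_flow_unique R m (- t) (rev Z) (rev X)).
  - by move=> s c /Js Js';
      exact: (is_derive_rev (newton_field_flip m 0) (proj1 (ZF _ Js'))).
  - move=> s c /Ts Ts'.
    exact: (is_derive_rev (newton_field_flip m 0) (fun c' => XN (- s) c' Ts')).
  - by move=> s i j /Js Js'; have [_ +] := ZF _ Js'; apply.
  - by move=> s i j /Ts; exact: dist_gt.
  - by rewrite /rev oppr0 Z0.
  - by rewrite oppr_ge0 ltW// lexx.
pose q' t := to_config e (X t).
have qZ t : q t = to_config e (Z t) by rewrite to_of_config.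
have agree t : J t -> I t -> q t = q' t by move=> Jt It; rewrite qZ ZX.
(* The glued solution extends the maximal one, so its domain cannot exceed [J]. *)
have IJ : I `<=` J.
  have glue := solution_glue sol solI J0 I0 agree.
  have sub := max _ _ glue (fun t Jt => or_introl Jt) _.
  move=> t It; apply: sub; last by right.
  by move=> s Js; rewrite asboolT.
have qE t : I t -> q t = q' t by move=> It; exact: agree (IJ t It) It.
have area_cont (W : R -> coord -> R) : (forall t c, is_derive t 1 (W^~ c)
    (cut_field m N d (W t) c)) ->
    continuous (fun t => area (W t)).
  move=> WE t.
  have c i j k := is_deriveB_fun (WE t (pos i k)) (WE t (pos j k)).
  exact: is_derive_continuous (is_deriveB_fun (is_deriveM_fun (c i1 i0 0) (c i2 i0
      1)) (is_deriveM_fun (c i2 i0 0) (c i1 i0 1))).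
have [t1 [/andP[t10 t1T] area1 before1]] :=
  first_zero (area_cont X XE) T0 areaX0 areaXT.
have areaR0 : 0 < area (rev X 0) by rewrite /rev oppr0.
have [t2 [/andP[t20 t2T] area2 before2]] :=
  first_zero (area_cont (rev X) revE) T0 areaR0 areaRT.
have areaR t : area (rev X t) = area (X (- t)) by [].
rewrite areaR in area2.
have I1 : I t1 by rewrite /I /= gtr0_norm.
have I2 : I (- t2) by rewrite /I /= normrN gtr0_norm.
have syz t : I t -> area (X t) = 0 -> syzygy_of_type (q t) i1.
  move=> It; rewrite qE//; apply: area_syzygy en0 d0 (X_None t) _.
  by have [] := abs_tube t (IT t It).
exists i1, [:: - t2; t1]; split=> //.
- by rewrite /= andbT; lra.
- by move=> t; rewrite !inE => /orP[/eqP ->|/eqP ->]; exact: IJ.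
- by move=> [|[|//]] _ /=; exact: syz.
move=> s t s' sts s'ts st [col _].
have /andP[tl tr] : - t2 <= t <= t1.
  have sl : - t2 <= s by move: sts; rewrite !inE => /orP[/eqP ->|/eqP ->]; lra.
  have sr : s' <= t1 by move: s'ts; rewrite !inE => /orP[/eqP ->|/eqP ->]; lra.
  by move/andP: st => [? ?]; apply/andP; split; lra.
have It : I t by rewrite /I /= ltr_norml; apply/andP; split; lra.
(* Every syzygy, with or without collision, is a zero of the area, and [t1], [t2] are the first
   zeros in the two time directions. *)
have At : area (X t) = 0 by apply: collinear_area en0 _; rewrite -/(q' t) -qE.
rewrite !inE; have [t0|t0] := leP 0 t.
  move: tr; rewrite le_eqVlt => /predU1P[->|tlt]; first by rewrite eqxx orbT.
  by have := before1 t; rewrite t0 tlt At eqxx => /(_ isT).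
move: tl; rewrite le_eqVlt => /predU1P[->|tlt]; first by rewrite eqxx.
have := before2 (- t); rewrite areaR opprK At eqxx => /(_ _)/negP; case=> //.
by apply/andP; split; lra.
Qed.

End Stutter.

(** * The open and unbounded set in the phase space *)

Section PhaseSpace.
Context {R : realType}.
Implicit Types (m a b : 'I_3 -> R) (w K r e : R).

(** The equation for [b] is linear in [b], with coefficients homogeneous of degree -3 in [a]; so
    only [a] is dilated, and [w], [K] are divided by [r ^+ 3]. *)
Lemma euler_configuration_scale m a b w K r : 0 < r ->
  euler_configuration m a b w K ->
  euler_configuration m (fun i => r * a i) b (w / r ^+ 3) (K / r ^+ 3).
Proof.
move=> r0 [/andP[w0 wK] /andP[a01 a12] [ma mb] [aE bE] A0].
have r30 : 0 < r ^+ 3 by rewrite exprn_gt0.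
have rn : r != 0 by rewrite gt_eqF.
split.
- by rewrite divr_gt0// ltr_pM2r ?invr_gt0.
- by rewrite !ltr_pM2l// a01.
- split=> //; rewrite (eq_bigr (fun i => r * (m i * a i))) => [|i _];
    last by rewrite mulrCA.
  by rewrite -big_distrr ma /= mulr0.
- split=> i.
    have -> : - (w / r ^+ 3) * (r * a i) = (r ^+ 2)^-1 * (- w * a i) by field.
    rewrite -aE big_distrr; apply: eq_bigr => j _ /=.
    rewrite -mulrBr normrM exprMn (gtr0_norm r0) [(r ^+ 3 * _)^-1]invfM.
    by move: (`|_| ^+ 3)^-1 => z; field.
  have -> : - (K / r ^+ 3) * b i = (r ^+ 3)^-1 * (- K * b i) by field.
  rewrite -bE big_distrr; apply: eq_bigr => j _ /=.
  rewrite -mulrBr normrM exprMn (gtr0_norm r0) [(r ^+ 3 * _)^-1]invfM.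
  by move: (`|_| ^+ 3)^-1 => z; field.
- rewrite -!mulrBr -!mulrA -mulrBr; exact: mulr_gt0.
Qed.

Lemma of_state_continuous e (c : coord) :
  continuous (fun z : config R * config R => of_state e z.1 z.2 c).
Proof.
case: c => [[f [i k]]|] z; last exact: cvg_cst.
rewrite /of_state; apply: cvgM; last exact: cvg_cst.
case: f.
  apply: (continuous_comp (f := snd) (g := fun M : config R => M i k)).
    exact: cvg_snd.
  exact: coord_continuous.
apply: (continuous_comp (f := fst) (g := fun M : config R => M i k)).
  exact: cvg_fst.
exact: coord_continuous.
Qed.

Lemma potential_gt0 m (q : config R) : (forall i, 0 < m i) -> collision_free q ->
  0 < potential m q.
Proof.
move=> m_gt0 cf; have t i j : i != j -> 0 < m i * m j / enorm (row i q - row j q).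
  by move=> ij; rewrite divr_gt0 ?mulr_gt0// enorm_gt0// subr_eq0 cf.
rewrite /potential sum3.
rewrite [X in X + _ + _]big_mkcond [X in _ + X + _]big_mkcond [X in _ + _ +
    X]big_mkcond.
by rewrite !sum3 /= !(addr0, add0r) !addr_gt0// t.
Qed.

Lemma euler_rest_phase_space m a b w K e : (forall i, 0 < m i) -> 0 < e ->
  euler_configuration m a b w K ->
  phase_space m (to_config e (euler_state a b 1 0 1 0), 0).
Proof.
move=> m_gt0 e0 [_ /andP[a01 a12] [ma mb] _ _].
set q := to_config _ _.
have q0 i : q i 0 = a i by rewrite !mxE /= /scale /= !mul1r.
have q1 i : q i 1 = e * b i by rewrite !mxE /= /scale /= !mul1r.
have cf : collision_free q.
  move=> i j ij; apply/negP => /eqP/rowP/(_ 0); rewrite [LHS]mxE [RHS]mxE !q0;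
      move: ij.
  by elim/ord3_ind: i; elim/ord3_ind: j => // _; lra.
split=> //=.
- apply/rowP => k; rewrite summxE mxE; move: k; apply: ord2_ind.
    by rewrite -[RHS]ma; apply: eq_bigr => i _; rewrite mxE mxE q0.
  transitivity (e * \sum_i m i * b i); last by rewrite mb mulr0.
  rewrite big_distrr; apply: eq_bigr => i _; rewrite mxE mxE q1 /=; ring.
- by apply: big1 => i _; rewrite row0 scaler0.
- rewrite /energy big1 ?mulr0 ?sub0r ?oppr_lt0 ?potential_gt0// => i _.
  by rewrite row0 enormE !mxE !expr0n addr0 sqrtr0 expr0n mulr0.
- by rewrite /angular_momentum big1// => i _; rewrite !mxE !mulr0 subrr mulr0.
Qed.

Definition stutters m (x : config R * config R) : Prop :=
  forall (J : set R) (q : R -> config R), maximal_solution m J q -> J 0 ->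
    q 0 = x.1 -> derive1 q 0 = x.2 -> stuttering J q.

Lemma stutters_near_euler m a b w K : (forall i, 0 < m i) ->
  euler_configuration m a b w K ->
  exists V : set (config R * config R), [/\ open V, V `<=` stutters m &
    exists2 x, V x /\ phase_space m x & forall i, x.1 i 0 = a i].
Proof.
move=> m_gt0 euler; have [h h0 near_stutter] := stutter_near_euler m_gt0 euler.
(* The scale must be positive for an actual planar configuration, yet within [h] of the value 0 of
   the reference. *)
pose e := h / 2; have e0 : 0 < e by rewrite divr_gt0.
pose Y := euler_state a b 1 0 1 0.
exists [set x | forall c, `|of_state e x.1 x.2 c - Y c| < h]; split.
- rewrite openE => x Vx; rewrite /interior /=.
  pose P (c : coord) : set (config R * config R) :=
    [set z | `|of_state e z.1 z.2 c - Y c| < h].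
  have : \forall z \near x, forall c, P c z.
    apply: (@filter_forall _ _ P (nbhs x) _) => c.
    have r0 : 0 < h - `|of_state e x.1 x.2 c - Y c| by rewrite subr_gt0.
    have /cvgrPdist_lt/(_ _ r0) := @of_state_continuous e c x.
    apply: filterS => z /= zx; rewrite /P /=.
    have -> : of_state e z.1 z.2 c - Y c = (of_state e x.1 x.2 c - Y c) -
      (of_state e x.1 x.2 c - of_state e z.1 z.2 c) by ring.
    by apply: (le_lt_trans (ler_normB _ _)); move: zx; lra.
  by [].
- move=> x Vx J q; apply: (near_stutter e) => // c; exact: ltW.
exists (to_config e Y, 0).
  split; last exact: euler_rest_phase_space euler.
  have en0 : e != 0 by rewrite gt_eqF.
  move=> [[f [i k]]|] /=;
      last by rewrite subr0 gtr0_norm// /e ltr_pdivrMr// ltr_pMr// ltr1n.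
  have sk := scale_neq0 k en0.
  case: f; first by rewrite mxE mul0r; case: ifP; rewrite mul0r subr0 normr0.
  by rewrite mxE /= mulrC mulKf// subrr normr0.
by move=> i; rewrite mxE /scale /= !mul1r.
Qed.

End PhaseSpace.

Unset Implicit Arguments.

Theorem corollary1 (R : realType) (m : 'I_3 -> R) (m_gt0 : forall i, 0 < m i) :
  exists A : set (config R * config R),
    [/\ A !=set0,
        exists2 V : set (config R * config R),
          open V & A = phase_space m `&` V,
        ~ bounded_set A &
        forall x : config R * config R, A x ->
        forall (J : set R) (q : R -> config R),
          maximal_solution m J q -> J 0 ->
          q 0 = x.1 -> derive1 q 0 = x.2 ->
          stuttering J q].
Proof.
have [a [b [w [K euler]]]] := euler_exists m_gt0.
(* The tolerance depends on the size of the Euler configuration, so neighbourhoods for all sizes are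
   collected in the largest open set of stuttering states. *)
pose V := \bigcup_(U in [set U | open U /\ U `<=` stutters m]) U.
have point r : 0 < r -> exists2 x, (phase_space m `&` V) x & forall i, x.1 i 0 = r
    * a i.
  move=> r0; have [U [oU Us [x [Ux px] xa]]] :=
    stutters_near_euler m_gt0 (euler_configuration_scale r0 euler).
  by exists x => //; split=> //; exists U.
exists (phase_space m `&` V); split.
- by have [x xA _] := point 1 ltr01; exists x.
- by exists V => //; apply: bigcup_open => U [].
- move=> [M [_ /(_ (`|M| + 1))]];
    rewrite (le_lt_trans (ler_norm M)) ?ltrDl// => /(_ isT).
  move=> bnd.
  have [i ai0] : exists i, a i != 0.
    have [_ /andP[a01 _] _ _ _] := euler.
    have [a00|] := eqVneq (a i0) 0; last by exists i0.
    by exists i1; rewrite gt_eqF// -a00.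
  have na0 : 0 < `|a i| by rewrite normr_gt0.
  (* This dilation gives body [i] a first coordinate of absolute value [|M| + 2], above the tested
     bound [|M| + 1]. *)
  have r0 : 0 < (`|M| + 2) / `|a i| by rewrite divr_gt0// ltr_wpDl.
  have [x xA xa] := point _ r0.
  have := bnd x xA; apply/negP; rewrite -ltNge.
  apply: (@lt_le_trans _ _ `|x.1 i 0|).
    by rewrite xa normrM (gtr0_norm r0) divfK ?gt_eqF// ltrD2l ltr1n.
  apply: (@le_trans _ _ `|x.1|).
    by rewrite [leRHS]/Num.Def.normr /= mx_normrE; exact: (le_bigmax _ _ (i, 0)).
  by rewrite prod_normE le_max lexx.
- by move=> x [_ [U [_ Us] Ux]] J q; exact: Us.
Qed.
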